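(* Given $a_1,\alpha>0$, let $$\gamma_1=\Big\{(\alpha u,u):\ |u|\le\tfrac{a_1\alpha}{\sqrt{\alpha^2+1}}\Big\},\qquad \gamma_2=\{(x,0):\ |x|\le a_1\}$$ be line segments in the $xy$-plane of $\mathbb R^3$. Let $\tilde k\in C^1(\gamma_1)$ and $\bar k_2\in C^0(\gamma_2)$. Then for any $a\in(0,a_1)$ there is $\delta>0$ such that if $$\bar k=\max_{|x|\le a_1}\Big\{\big|\tilde k\big(x\,\alpha/\sqrt{\alpha^2+1}\big)\big|,\ |\bar k_2(x)|\Big\}<\delta,$$ then there exists a unique PC surface $M^2:\ z=f(x,y)$ in $\mathbb R^3$, where $f\in C^2(\Pi(a))$ and $f(0,0)=0$, $df(0,0)=0$, with the properties: -- the principal direction $\partial_1$ is orthogonal to the vector $e_1-\alpha e_2$; -- $\tilde k$ is the principal curvature of $M^2$ over $\gamma_1\cap\Pi(a)$ corresponding to $\partial_1$; -- $\bar k_2$ is the principal curvature of $M^2$ over $\gamma_2\cap\Pi(a)$ corresponding to the second principal direction $\partial_2$. The solution can be found using reconstruction of two planar curves by their curvature functions.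
   Context: $e_1,e_2,e_3$ is the standard basis of $\mathbb R^3$ with cartesian coordinates $(x,y,z)$. For $a,\alpha>0$, $\Pi(a)=\{(x,y):\ |\alpha x+y|\le a\alpha,\ |x-\alpha y|\le a\}$ is a rectangle in the $xy$-plane. The function $\tilde k$ on $\gamma_1$ is written as a function of the parameter $u$, and $\bar k_2$ on $\gamma_2$ as a function of $x$. A surface $M^2\subset\mathbb R^3$ is called parallel curved (PC) if there is a totally umbilical or totally geodesic surface $\beta\subset\mathbb R^3$ (a sphere or a plane) such that at each point of $M^2$ there is a principal direction tangent to the parallel surface $\beta_d$ (the surface at distance $d$ from $\beta$) through that point. Graphs are oriented by the upward unit normal, with second fundamental form coefficients $f_{xx},f_{xy},f_{yy}$ divided by $\sqrt{1+f_x^2+f_y^2}$. $\partial_1,\partial_2$ are orthogonal principal directions; the principal curvature corresponding to $\partial_i$ is the eigenvalue of the shape operator for $\partial_i$. A principal curvature ''over'' a set in the $xy$-plane means its value at the points of $M^2$ projecting orthogonally to that set.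
   Formalization: Uniqueness in C²(Π(a)) fails near the sides of Π(a) orthogonal to γ_1; here M² over Π(a) is unique among surfaces that solve the problem over a larger Π(a'), a<a'≤a_1, with δ depending also on a'. The remark on reconstructing two planar curves is left out. *)

(* Defs.v *)
From Stdlib Require Import Reals.
From Coquelicot Require Import Coquelicot.
Open Scope R_scope.

Definition vec3 : Type := (R * R * R)%type.

Definition dot3 (v w : vec3) : R :=
  let '(v1, v2, v3) := v in
  let '(w1, w2, w3) := w in
  v1 * w1 + v2 * w2 + v3 * w3.

Definition sub3 (v w : vec3) : vec3 :=
  let '(v1, v2, v3) := v in
  let '(w1, w2, w3) := w in
  (v1 - w1, v2 - w2, v3 - w3).

Definition dx (f : R -> R -> R) (x y : R) : R := Derive (fun u => f u y) x.
Definition dy (f : R -> R -> R) (x y : R) : R := Derive (fun v => f x v) y.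

(* C^2 on a closed region is read as C^2 on a neighbourhood of it; for a
   rectangle this is, up to the choice of the extension, the same as having
   partial derivatives up to order 2 that are continuous up to the boundary. *)
Definition C2_on (D : R -> R -> Prop) (f : R -> R -> R) : Prop :=
  forall x y, D x y -> locally_2d (fun u v => ex_diff_n f 2 u v) x y.

(* The filter [within D] makes the derivatives one-sided at the ends of an
   interval: only the restriction of [k] to [D] matters. *)
Definition C1_on (D : R -> Prop) (k : R -> R) : Prop :=
  exists dk : R -> R,
    continuous_on D dk /\
    forall u, D u ->
      filterdiff k (within D (locally u)) (fun h => scal h (dk u)).

Definition is_maximum (E : R -> Prop) (m : R) : Prop :=
  E m /\ is_upper_bound E m.

(* Tangent vectors of the graph of [f] at (x, y, f x y) are given by their
   coordinates (p, q) in the basis (1, 0, f_x), (0, 1, f_y). *)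
Definition graph_point (f : R -> R -> R) (x y : R) : vec3 := (x, y, f x y).

Definition tangent_vec (f : R -> R -> R) (x y : R) (v : R * R) : vec3 :=
  (fst v, snd v, fst v * dx f x y + snd v * dy f x y).

(* The product of the inverse of the first fundamental form with the second
   one, with respect to the upward unit normal. *)
Definition shape_operator (f : R -> R -> R) (x y : R) (v : R * R) : R * R :=
  let E := 1 + dx f x y ^ 2 in
  let F := dx f x y * dy f x y in
  let G := 1 + dy f x y ^ 2 in
  let W := sqrt (1 + dx f x y ^ 2 + dy f x y ^ 2) in
  let L := dx (dx f) x y / W in
  let M := dy (dx f) x y / W in
  let N := dy (dy f) x y / W in
  let IIp := L * fst v + M * snd v in
  let IIq := M * fst v + N * snd v in
  ((G * IIp - F * IIq) / (E * G - F ^ 2),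
   (E * IIq - F * IIp) / (E * G - F ^ 2)).

Definition principal (f : R -> R -> R) (x y : R) (v : R * R) (k : R) : Prop :=
  v <> (0, 0) /\ shape_operator f x y v = (k * fst v, k * snd v).

Definition principal_direction (f : R -> R -> R) (x y : R) (v : R * R) : Prop :=
  exists k, principal f x y v k.

Inductive umbilical_surface : Type :=
| Sphere (c : vec3) (r : R)
| Plane (n : vec3) (h : R).

Definition umbilical_wf (beta : umbilical_surface) : Prop :=
  match beta with
  | Sphere _ r => 0 < r
  | Plane n _ => dot3 n n = 1
  end.

(* [parallel beta d p]: the point p lies on the parallel surface at signed
   distance d from beta (d > - r for a sphere of radius r, so that the parallel
   surface does not degenerate to the centre). *)
Definition parallel (beta : umbilical_surface) (d : R) (p : vec3) : Prop :=
  match beta with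
  | Sphere c r => 0 < r + d /\ sqrt (dot3 (sub3 p c) (sub3 p c)) = r + d
  | Plane n h => dot3 n p = h + d
  end.

Definition parallel_normal (beta : umbilical_surface) (p : vec3) : vec3 :=
  match beta with
  | Sphere c _ => sub3 p c
  | Plane n _ => n
  end.

Definition tangent_to_parallel (beta : umbilical_surface) (p v : vec3) : Prop :=
  exists d, parallel beta d p /\ dot3 (parallel_normal beta p) v = 0.

Definition parallel_curved (D : R -> R -> Prop) (f : R -> R -> R) : Prop :=
  exists beta, umbilical_wf beta /\
    forall x y, D x y ->
      exists v, principal_direction f x y v /\
        tangent_to_parallel beta (graph_point f x y) (tangent_vec f x y v).

Definition principal_frame (D : R -> R -> Prop) (f : R -> R -> R)
    (d1 d2 : R -> R -> R * R) : Prop :=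
  forall x y, D x y ->
    principal_direction f x y (d1 x y) /\
    principal_direction f x y (d2 x y) /\
    dot3 (tangent_vec f x y (d1 x y)) (tangent_vec f x y (d2 x y)) = 0.

Definition Pi (alpha a : R) (x y : R) : Prop :=
  Rabs (alpha * x + y) <= a * alpha /\ Rabs (x - alpha * y) <= a.

(* The parameter intervals of the segments (alpha u, u) and (x, 0). *)
Definition gamma1_dom (alpha a1 : R) (u : R) : Prop :=
  Rabs u <= a1 * alpha / sqrt (alpha ^ 2 + 1).

Definition gamma2_dom (a1 : R) (x : R) : Prop := Rabs x <= a1.

Definition curvature_values (alpha a1 : R) (kt k2 : R -> R) (v : R) : Prop :=
  exists x, Rabs x <= a1 /\
    (v = Rabs (kt (x * alpha / sqrt (alpha ^ 2 + 1))) \/ v = Rabs (k2 x)).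

(* The values of f over Pi(a) near the two sides orthogonal to gamma1 are
   influenced by the curvature over points of gamma1 beyond Pi(a).  Hence a
   solution over Pi(a) alone is not unique up to these sides, and uniqueness
   over Pi(a) is only meaningful among solutions over some Pi(a') with a' > a. *)
Definition PC_solution (alpha a1 : R) (kt k2 : R -> R) (a : R)
    (f : R -> R -> R) : Prop :=
  C2_on (Pi alpha a) f /\
  f 0 0 = 0 /\ dx f 0 0 = 0 /\ dy f 0 0 = 0 /\
  parallel_curved (Pi alpha a) f /\
  exists d1 d2 : R -> R -> R * R,
    principal_frame (Pi alpha a) f d1 d2 /\
    (forall x y, Pi alpha a x y ->
       dot3 (tangent_vec f x y (d1 x y)) (1, - alpha, 0) = 0) /\
    (forall u, gamma1_dom alpha a1 u -> Pi alpha a (alpha * u) u ->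
       principal f (alpha * u) u (d1 (alpha * u) u) (kt u)) /\
    (forall x, gamma2_dom a1 x -> Pi alpha a x 0 ->
       principal f x 0 (d2 x 0) (k2 x)).

(* Main.v *)
(* In the orthonormal coordinates s along and t across gamma_1, the direction of
   d1 is the s-coordinate direction, and this direction is principal exactly when
   (1 + F_s^2) F_st = F_s F_t F_ss, that is, when F_t / sqrt (1 + F_s^2) is a
   function h' of t alone.  Hence a solution is a moulding surface: the section at
   t is the parallel curve at distance h t of the section at t = 0.  The curvature
   k1 over t = 0 is that of the plane curve z = G s, and k2 depends on t only and
   is the curvature of the plane curve z = h t, so that both curves are found by
   integrating their curvature.  Conversely, for small curvature the normals of
   z = G s provide the coordinates (sigma, h t) on which the surface is explicit.
   Uniqueness is the method of characteristics: F_s is constant along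
   t -> (sigma - h t * S sigma, t), S being the sine of the tangent angle of z = G s. *)
Require Import Defs.
From Stdlib Require Import Reals Lra Psatz.
From Coquelicot Require Import Coquelicot.
Open Scope R_scope.

(** * Plane curves and their tangent angle *)

(** For a graph z = G(x) with tangent angle theta, the derivative of sin theta with respect to the
    abscissa x is exactly the curvature. So a curve whose curvature is given as a function of x is
    recovered by two quadratures, and the sine rather than the slope is the natural unknown. The
    extended curvatures are only continuous, so the coordinate sigma is only C^1 in (s, t). The
    surface is nevertheless C^2: the derivatives of sigma cancel in its first derivatives, leaving
    functions of sigma and t that can be differentiated once more. Smallness of the curvature serves
    two purposes. The displacement h must not reach the focal points of z = G s, so that sigma
    exists and is differentiable. And for uniqueness over Pi(a), the characteristic through a point
    of Pi(a) must stay in Pi(a') over the whole range of t, so that its drift in s has to fit into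
    the margin c (a' - a). *)

Lemma continuity_pt_of_is_derive (f : R -> R) (x l : R) :
  is_derive f x l -> continuity_pt f x.
Proof.
  intros H. apply continuity_pt_filterlim.
  apply (ex_derive_continuous f). now exists l.
Qed.

Lemma nondecreasing_of_derive (f df : R -> R) (x y : R) :
  x <= y ->
  (forall z, x < z < y -> is_derive f z (df z)) ->
  (forall z, x <= z <= y -> continuity_pt f z) ->
  (forall z, x <= z <= y -> 0 <= df z) -> f x <= f y.
Proof.
  intros Hxy Hd Hc Hp.
  destruct (MVT_gen f x y df) as [z [Hz He]];
    rewrite ?Rmin_left, ?Rmax_right in * by lra; try assumption.
  pose proof (Hp z Hz). nra.
Qed.

Lemma constant_of_derive (f : R -> R) (x y : R) :
  (forall z, Rmin x y < z < Rmax x y -> is_derive f z 0) ->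
  (forall z, Rmin x y <= z <= Rmax x y -> continuity_pt f z) -> f y = f x.
Proof.
  intros Hd Hc.
  destruct (MVT_gen f x y (fun _ => 0)) as [z [Hz He]]; try assumption. lra.
Qed.

Lemma primitive_exists (f : R -> R) :
  (forall x, continuous f x) ->
  exists F : R -> R, F 0 = 0 /\ forall x, is_derive F x (f x).
Proof.
  intros Hf. exists (fun x => RInt f 0 x). split.
  - apply (RInt_point 0 f).
  - intros x. apply (is_derive_RInt f _ 0 x); [| apply Hf].
    apply filter_forall. intros y.
    apply (RInt_correct (V := R_CompleteNormedModule)).
    apply (ex_RInt_continuous (V := R_CompleteNormedModule)).
    intros; apply Hf.
Qed.

Definition clamp (L x : R) : R := Rmax (- L) (Rmin x L).

Lemma clamp_id (L x : R) : Rabs x <= L -> clamp L x = x.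
Proof.
  intros H. apply Rabs_le_between in H. unfold clamp.
  rewrite Rmin_left, Rmax_right; lra.
Qed.

Lemma clamp_bound (L x : R) : 0 <= L -> Rabs (clamp L x) <= L.
Proof.
  intros H. apply Rabs_le. unfold clamp, Rmax, Rmin.
  destruct (Rle_dec x L); destruct (Rle_dec (- L) _); lra.
Qed.

Lemma clamp_lipschitz (L x y : R) :
  0 <= L -> Rabs (clamp L x - clamp L y) <= Rabs (x - y).
Proof.
  intros H. unfold clamp, Rmax, Rmin.
  repeat destruct Rle_dec; unfold Rabs; repeat destruct Rcase_abs; lra.
Qed.

(** As [clamp] is 1-Lipschitz with values in the segment, one-sided continuity at the ends becomes
    continuity on the whole line, as primitives require. *)
Lemma continuous_of_clamp (L : R) (k : R -> R) :
  0 <= L -> continuous_on (fun x => Rabs x <= L) k ->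
  forall x, continuous (fun y => k (clamp L y)) x.
Proof.
  intros HL Hk x P HP.
  destruct (Hk (clamp L x) (clamp_bound L x HL) P HP) as [e He].
  exists e. intros y Hy. apply He; [| now apply clamp_bound].
  apply Rle_lt_trans with (2 := Hy). now apply clamp_lipschitz.
Qed.

Lemma continuous_clamp (L x : R) : 0 <= L -> continuous (clamp L) x.
Proof.
  intros HL. apply (continuous_of_clamp L (fun y => y)); try assumption.
  intros y Hy P [e HP]. exists e. intros; now apply HP.
Qed.

(* Beyond [-L, L] the curvature decays like 1/(1+x^2), so that the sine S of the
   tangent angle is small on the whole line and no curve ever turns vertical. *)
Lemma tangent_sine_exists (L eps : R) : 0 <= L -> 0 < eps ->
  exists delta, 0 < delta /\
  forall k : R -> R,
    continuous_on (fun x => Rabs x <= L) k ->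
    (forall x, Rabs x <= L -> Rabs (k x) < delta) ->
  exists kappa S : R -> R,
    (forall x, continuous kappa x) /\
    (forall x, Rabs x <= L -> kappa x = k x) /\
    (forall x, Rabs (kappa x) <= eps) /\
    S 0 = 0 /\ (forall x, is_derive S x (kappa x)) /\
    (forall x, Rabs (S x) <= eps).
Proof.
  intros HL Heps.
  assert (HM : 0 < 1 + L ^ 2) by nra.
  (* Since 1 + (clamp x)^2 is at most 1 + L^2, this [delta] gives |kappa x| <= (eps / 2) / (1 +
     x^2). *)
  set (delta := eps / (2 * (1 + L ^ 2))).
  assert (Hdelta : 0 < delta) by (apply Rdiv_lt_0_compat; lra).
  assert (Edelta : delta * (1 + L ^ 2) = eps / 2) by (unfold delta; field; lra).
  exists delta; split; [assumption|]. intros k Hk Hkb.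
  set (kappa := fun x => k (clamp L x) * ((1 + clamp L x ^ 2) / (1 + x ^ 2))).
  assert (Hcont : forall x, continuous kappa x).
  { intros x. apply (continuous_mult (fun x => k (clamp L x))).
    - now apply continuous_of_clamp.
    - apply (continuous_mult (fun x => 1 + clamp L x ^ 2) (fun x => / (1 + x ^ 2))).
      + apply (continuous_comp (clamp L) (fun y => 1 + y ^ 2)).
        * now apply continuous_clamp.
        * apply (ex_derive_continuous (fun y : R => 1 + y ^ 2)). auto_derive; trivial.
      + apply (ex_derive_continuous (fun y : R => / (1 + y ^ 2))). auto_derive. nra. }
  assert (Hbd : forall x, Rabs (kappa x) <= eps / 2 * / (1 + x ^ 2)).
  { intros x. unfold kappa.
    pose proof (clamp_bound L x HL) as Hc.
    pose proof (Hkb _ Hc) as Hk1.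
    assert (Hx : 0 < / (1 + x ^ 2)) by (apply Rinv_0_lt_compat; nra).
    rewrite Rabs_mult. rewrite (Rabs_pos_eq (_ / _)).
    2:{ apply Rmult_le_pos; [nra | lra]. }
    rewrite <- Edelta. unfold Rdiv. rewrite <- Rmult_assoc.
    apply Rmult_le_compat_r; [lra|].
    apply Rmult_le_compat; try lra; [apply Rabs_pos | nra |].
    apply Rabs_le_between in Hc. nra. }
  destruct (primitive_exists kappa Hcont) as [S [S0 HS]].
  exists kappa, S. split; [exact Hcont|]. split.
  { intros x Hx. unfold kappa. rewrite clamp_id by assumption. field. nra. }
  split.
  { intros x. eapply Rle_trans; [apply Hbd|].
    assert (/ (1 + x ^ 2) <= 1).
    { rewrite <- Rinv_1. apply Rinv_le_contravar; nra. }
    nra. }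
  split; [exact S0|]. split; [exact HS|].
  assert (Hat : forall x, is_derive atan x (/ (1 + x ^ 2))).
  { intros x. apply is_derive_Reals.
    apply derivable_pt_lim_atan. }
  (* Both (eps / 2) atan + S and (eps / 2) atan - S are nondecreasing. Comparison with their value
     at 0 bounds |S| by (eps / 2)(PI / 2), which is at most [eps] as PI <= 4. *)
  assert (Hmono : forall s, s = 1 \/ s = -1 -> forall x y, x <= y ->
      eps / 2 * atan x + s * S x <= eps / 2 * atan y + s * S y).
  { intros s Hs x y Hxy.
    assert (Hd : forall z, is_derive (fun x => eps / 2 * atan x + s * S x) z
              (eps / 2 * / (1 + z ^ 2) + s * kappa z)).
    { intros z. apply (is_derive_plus (V := R_NormedModule)).
      - apply is_derive_scal, Hat.
      - apply is_derive_scal, HS. }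
    apply (nondecreasing_of_derive (fun x => eps / 2 * atan x + s * S x) (fun z => eps / 2 * / (1 + z ^ 2) + s * kappa z));
      trivial.
    - intros z _. eapply continuity_pt_of_is_derive, Hd.
    - intros z _. pose proof (Hbd z) as Hz. apply Rabs_le_between in Hz.
      destruct Hs; subst s; lra. }
  intros x.
  pose proof (atan_bound x) as Ha. pose proof PI_4.
  assert (atan 0 = 0) by apply atan_0.
  apply Rabs_le.
  destruct (Rle_dec 0 x) as [Hx|Hx].
  - pose proof (Hmono 1 (or_introl eq_refl) 0 x Hx).
    pose proof (Hmono (-1) (or_intror eq_refl) 0 x Hx).
    split; nra.
  - assert (Hx' : x <= 0) by lra.
    pose proof (Hmono 1 (or_introl eq_refl) x 0 Hx').
    pose proof (Hmono (-1) (or_intror eq_refl) x 0 Hx').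
    split; nra.
Qed.

(* The tangent angle of a curve never appears: its cosine and slope are functions
   of its sine q, and its sine is a function of the slope p. *)
Definition cosine (q : R) : R := sqrt (1 - q ^ 2).
Definition slope (q : R) : R := q / cosine q.
Definition sine (p : R) : R := p / sqrt (1 + p ^ 2).

Lemma cosine_pos (q : R) : Rabs q < 1 -> 0 < cosine q.
Proof.
  intros H. apply Rabs_lt_between in H. apply sqrt_lt_R0. nra.
Qed.

Lemma cosine_sqr (q : R) : Rabs q < 1 -> cosine q ^ 2 = 1 - q ^ 2.
Proof.
  intros H. apply Rabs_lt_between in H. apply pow2_sqrt. nra.
Qed.

Lemma sqrt_1_slope (q : R) : Rabs q < 1 -> sqrt (1 + slope q ^ 2) = / cosine q.
Proof.
  intros H. pose proof (cosine_pos q H). pose proof (cosine_sqr q H).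
  apply sqrt_lem_1.
  - nra.
  - left; now apply Rinv_0_lt_compat.
  - unfold slope. replace (q ^ 2) with (1 - cosine q ^ 2) by lra.
    replace ((q / cosine q) ^ 2) with (q ^ 2 / cosine q ^ 2) by (field; lra).
    replace (q ^ 2) with (1 - cosine q ^ 2) by lra. field; lra.
Qed.

Lemma sine_slope (q : R) : Rabs q < 1 -> sine (slope q) = q.
Proof.
  intros H. unfold sine. rewrite sqrt_1_slope by assumption.
  pose proof (cosine_pos q H). unfold slope. field; lra.
Qed.

Lemma sqrt_1_sqr_pos (p : R) : 0 < sqrt (1 + p ^ 2).
Proof. apply sqrt_lt_R0. nra. Qed.

Lemma sqrt_1_sqr_sqr (p : R) : sqrt (1 + p ^ 2) ^ 2 = 1 + p ^ 2.
Proof. apply pow2_sqrt. nra. Qed.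

Lemma slope_sine (p : R) : slope (sine p) = p.
Proof.
  pose proof (sqrt_1_sqr_pos p). pose proof (sqrt_1_sqr_sqr p).
  assert (E : cosine (sine p) = / sqrt (1 + p ^ 2)).
  { unfold cosine. apply sqrt_lem_1.
    - unfold sine. replace ((p / sqrt (1 + p ^ 2)) ^ 2) with (p ^ 2 / (sqrt (1 + p ^ 2) ^ 2)) by (field; lra).
      rewrite H0. replace (1 - p ^ 2 / (1 + p ^ 2)) with (/ (1 + p ^ 2)) by (field; nra).
      left; apply Rinv_0_lt_compat; nra.
    - left; now apply Rinv_0_lt_compat.
    - unfold sine.
      replace ((p / sqrt (1 + p ^ 2)) ^ 2) with ((sqrt (1 + p ^ 2) ^ 2 - 1) / (sqrt (1 + p ^ 2) ^ 2)).
      + field; lra.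
      + rewrite H0 at 1. field; lra. }
  unfold slope. rewrite E. unfold sine. field; lra.
Qed.

Lemma is_derive_cosine (q : R) : Rabs q < 1 -> is_derive cosine q (- slope q).
Proof.
  intros H. pose proof (cosine_pos q H). unfold cosine in *.
  apply Rabs_lt_between in H. auto_derive.
  - simpl; nra.
  - unfold slope, cosine. simpl. replace (1 + - (q * (q * 1))) with (1 - q * (q * 1)) by ring.
    simpl in H0. field. lra.
Qed.

Lemma is_derive_slope (q : R) : Rabs q < 1 -> is_derive slope q (/ cosine q ^ 3).
Proof.
  intros H. pose proof (cosine_pos q H).
  evar_last. unfold slope. apply (is_derive_div (fun q => q) cosine).
  - apply (is_derive_id q).
  - now apply is_derive_cosine.
  - lra.
  - simpl. unfold one; simpl. pose proof (cosine_sqr q H) as E.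
    unfold slope. apply Rminus_diag_uniq.
    transitivity ((cosine q ^ 2 - (1 - q ^ 2)) / cosine q ^ 3); [field; lra | rewrite E].
    unfold Rdiv; ring.
Qed.

Lemma is_derive_sine (p : R) : is_derive sine p (/ sqrt (1 + p ^ 2) ^ 3).
Proof.
  pose proof (sqrt_1_sqr_pos p) as Hp. pose proof (sqrt_1_sqr_sqr p) as E.
  unfold sine. auto_derive.
  - simpl in *; split; [nra | split; [lra | trivial]].
  - simpl in *. set (w := sqrt _) in *.
    apply Rminus_diag_uniq.
    transitivity ((w * (w * 1) - (1 + p * (p * 1))) / (w * (w * (w * 1)))); [|rewrite E].
    + field; lra.
    + unfold Rdiv; ring.
Qed.

(** The derivative of [sine] at c is the inverse of (1 + c^2)^(3/2), so the curvature equation for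
    the slope c says that [sine (c t)] has derivative k, like S. The equation is asked only for |t|
    < T, because in the uniqueness proof it holds only where a whole neighbourhood of t is under
    control. *)
Lemma sine_determined (k c S : R -> R) (T : R) :
  (forall t, Rabs t < T -> is_derive c t (k t * sqrt (1 + c t ^ 2) ^ 3)) ->
  (forall t, Rabs t <= T -> continuity_pt c t) ->
  (forall t, Rabs t <= T -> is_derive S t (k t)) ->
  c 0 = 0 -> S 0 = 0 ->
  forall t, Rabs t <= T -> sine (c t) = S t.
Proof.
  intros Hc Hcc HS c0 S0 t Ht.
  enough (sine (c t) - S t = sine (c 0) - S 0) as E.
  { rewrite c0, S0 in E. unfold sine in E at 2. lra. }
  assert (Hin : forall z, Rmin 0 t <= z <= Rmax 0 t -> Rabs z <= T).
  { intros z. apply Rabs_le_between in Ht. unfold Rmin, Rmax.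
    destruct Rle_dec; intros; apply Rabs_le; lra. }
  assert (Hin' : forall z, Rmin 0 t < z < Rmax 0 t -> Rabs z < T).
  { intros z. apply Rabs_le_between in Ht. unfold Rmin, Rmax.
    destruct Rle_dec; intros; apply Rabs_def1; lra. }
  apply (constant_of_derive (fun t => sine (c t) - S t)).
  - intros z Hz. pose proof (Hc z (Hin' z Hz)) as Hd.
    evar_last.
    + apply (is_derive_minus (V := R_NormedModule) (fun t => sine (c t)) S).
      * apply (is_derive_comp sine c); [apply is_derive_sine | exact Hd].
      * apply HS, Hin. lra.
    + pose proof (sqrt_1_sqr_pos (c z)).
      unfold minus, plus, opp, scal, mult; simpl; unfold mult; simpl. field. simpl in *; lra.
  - intros z Hz. apply continuity_pt_minus.
    + apply (continuity_pt_comp c sine); [now apply Hcc, Hin|].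
      eapply continuity_pt_of_is_derive, is_derive_sine.
    + eapply continuity_pt_of_is_derive, HS, Hin, Hz.
Qed.

(** * Twice continuously differentiable functions of two variables *)

Definition continuous_2d (F : R -> R -> R) (s t : R) : Prop :=
  continuous (fun p : R * R => F (fst p) (snd p)) (s, t).

Lemma continuity_2d_pt_continuous_2d (F : R -> R -> R) (s t : R) :
  continuity_2d_pt F s t <-> continuous_2d F s t.
Proof. apply continuity_2d_pt_filterlim. Qed.

Definition open_2d (U : R -> R -> Prop) : Prop :=
  forall s t, U s t -> locally_2d U s t.

(** Existence of both partial derivatives and continuity of the first one suffice for
    differentiability; this is the basis of the chain rule along curves. *)
Lemma filterdiff_of_partials (U : R -> R -> Prop) (F P Q : R -> R -> R) (s t : R) :
  open_2d U ->
  (forall s t, U s t -> is_derive (fun u => F u t) s (P s t)) ->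
  (forall s t, U s t -> is_derive (F s) t (Q s t)) ->
  U s t -> continuous_2d P s t ->
  filterdiff (fun p : R * R => F (fst p) (snd p)) (locally (s, t))
    (fun p : R * R => plus (scal (fst p) (P s t)) (scal (snd p) (Q s t))).
Proof.
  intros HU HP HQ Hz HPc.
  apply (is_derive_filterdiff F s t P (Q s t)).
  - apply (locally_2d_locally (fun s t => is_derive (fun u => F u t) s (P s t))).
    eapply locally_2d_impl; [| apply HU, Hz].
    apply locally_2d_forall. intros u v Huv. now apply HP.
  - now apply HQ.
  - exact HPc.
Qed.

Lemma is_derive_along (U : R -> R -> Prop) (F P Q : R -> R -> R)
    (a b : R -> R) (z da db : R) :
  open_2d U ->
  (forall s t, U s t -> is_derive (fun u => F u t) s (P s t)) ->
  (forall s t, U s t -> is_derive (F s) t (Q s t)) ->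
  U (a z) (b z) -> continuous_2d P (a z) (b z) ->
  is_derive a z da -> is_derive b z db ->
  is_derive (fun u => F (a u) (b u)) z
    (da * P (a z) (b z) + db * Q (a z) (b z)).
Proof.
  intros HU HP HQ Hz HPc Ha Hb.
  eapply filterdiff_ext_lin.
  - apply (filterdiff_comp'_2 a b F z (fun h => scal h da) (fun h => scal h db)
      (fun h k => plus (scal h (P (a z) (b z))) (scal k (Q (a z) (b z)))) Ha Hb).
    now apply (filterdiff_of_partials U F P Q).
  - intros u. simpl. unfold plus, scal, mult; simpl. unfold mult; simpl. ring.
Qed.

Lemma continuous_2d_of_partials (U : R -> R -> Prop) (F P Q : R -> R -> R) (s t : R) :
  open_2d U ->
  (forall s t, U s t -> is_derive (fun u => F u t) s (P s t)) ->
  (forall s t, U s t -> is_derive (F s) t (Q s t)) ->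
  U s t -> continuous_2d P s t -> continuous_2d F s t.
Proof.
  intros HU HP HQ Hz HPc.
  apply (filterdiff_continuous (fun p : R * R => F (fst p) (snd p))).
  eexists. now apply (filterdiff_of_partials U F P Q).
Qed.

(** The derivatives are explicit functions rather than [Derive] terms, so that a surface given by
    formulas is checked by differentiating these. One function [B] serves both mixed derivatives. *)
Record C2_jet (U : R -> R -> Prop) (F P Q A B C : R -> R -> R) : Prop := {
  jet_open : open_2d U;
  jet_P : forall s t, U s t -> is_derive (fun u => F u t) s (P s t);
  jet_Q : forall s t, U s t -> is_derive (F s) t (Q s t);
  jet_A : forall s t, U s t -> is_derive (fun u => P u t) s (A s t);
  jet_Pt : forall s t, U s t -> is_derive (P s) t (B s t);
  jet_Qs : forall s t, U s t -> is_derive (fun u => Q u t) s (B s t);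
  jet_C : forall s t, U s t -> is_derive (Q s) t (C s t);
  jet_Ac : forall s t, U s t -> continuous_2d A s t;
  jet_Bc : forall s t, U s t -> continuous_2d B s t;
  jet_Cc : forall s t, U s t -> continuous_2d C s t
}.

Lemma jet_Pc U F P Q A B C s t :
  C2_jet U F P Q A B C -> U s t -> continuous_2d P s t.
Proof.
  intros J H. apply (continuous_2d_of_partials U P A B); try apply J; assumption.
Qed.

Lemma jet_Qc U F P Q A B C s t :
  C2_jet U F P Q A B C -> U s t -> continuous_2d Q s t.
Proof.
  intros J H. apply (continuous_2d_of_partials U Q B C); try apply J; assumption.
Qed.

Lemma jet_Fc U F P Q A B C s t :
  C2_jet U F P Q A B C -> U s t -> continuous_2d F s t.
Proof.
  intros J H. apply (continuous_2d_of_partials U F P Q); try apply J; try assumption.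
  eapply jet_Pc; eassumption.
Qed.

Lemma ex_diff_n_S_of_partials (U : R -> R -> Prop) (F P Q : R -> R -> R) (n : nat) (s t : R) :
  open_2d U ->
  (forall s t, U s t -> is_derive (fun u => F u t) s (P s t)) ->
  (forall s t, U s t -> is_derive (F s) t (Q s t)) ->
  U s t -> continuous_2d F s t ->
  ex_diff_n P n s t -> ex_diff_n Q n s t -> ex_diff_n F (S n) s t.
Proof.
  intros HU HP HQ Hz HF HPn HQn. simpl. split; [| split; [| split; [| split]]].
  - now apply continuity_2d_pt_continuous_2d.
  - eexists; now apply HP.
  - eexists; now apply HQ.
  - eapply ex_diff_n_ext_loc; [| exact HPn].
    eapply locally_2d_impl; [| apply HU, Hz].
    apply locally_2d_forall. intros u v Huv. symmetry. now apply is_derive_unique, HP.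
  - eapply ex_diff_n_ext_loc; [| exact HQn].
    eapply locally_2d_impl; [| apply HU, Hz].
    apply locally_2d_forall. intros u v Huv. symmetry. now apply is_derive_unique, HQ.
Qed.

Lemma jet_ex_diff_n U F P Q A B C s t :
  C2_jet U F P Q A B C -> U s t -> ex_diff_n F 2 s t.
Proof.
  intros J H. pose proof (jet_open _ _ _ _ _ _ _ J) as HU.
  assert (H0 : forall D : R -> R -> R, continuous_2d D s t -> ex_diff_n D 0 s t).
  { intros D HD. split; [now apply continuity_2d_pt_continuous_2d | trivial]. }
  apply (ex_diff_n_S_of_partials U F P Q); try apply J; try assumption.
  - eapply jet_Fc; eassumption.
  - apply (ex_diff_n_S_of_partials U P A B); try apply J; try assumption.
    + eapply jet_Pc; eassumption.
    + apply H0. now apply J.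
    + apply H0. now apply J.
  - apply (ex_diff_n_S_of_partials U Q B C); try apply J; try assumption.
    + eapply jet_Qc; eassumption.
    + apply H0. now apply J.
    + apply H0. now apply J.
Qed.

Lemma jet_values U F P Q A B C s t :
  C2_jet U F P Q A B C -> U s t ->
  dx F s t = P s t /\ dy F s t = Q s t /\ dx (dx F) s t = A s t /\
  dy (dx F) s t = B s t /\ dy (dy F) s t = C s t.
Proof.
  intros J H. pose proof (jet_open _ _ _ _ _ _ _ J) as HU.
  assert (EP : forall u v, U u v -> dx F u v = P u v)
    by (intros; now apply is_derive_unique, J).
  assert (EQ : forall u v, U u v -> dy F u v = Q u v)
    by (intros; now apply is_derive_unique, J).
  split; [now apply EP|]. split; [now apply EQ|].
  pose proof (locally_2d_1d_const_y _ _ _ (HU _ _ H)) as Hx.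
  pose proof (locally_2d_1d_const_x _ _ _ (HU _ _ H)) as Hy.
  split; [| split].
  - unfold dx at 1. rewrite (Derive_ext_loc _ (fun u => P u t)).
    + now apply is_derive_unique, J.
    + eapply filter_imp; [| exact Hx]. intros; now apply EP.
  - unfold dy at 1. rewrite (Derive_ext_loc _ (fun u => P s u)).
    + now apply is_derive_unique, J.
    + eapply filter_imp; [| exact Hy]. intros; now apply EP.
  - unfold dy at 1. rewrite (Derive_ext_loc _ (fun u => Q s u)).
    + now apply is_derive_unique, J.
    + eapply filter_imp; [| exact Hy]. intros; now apply EQ.
Qed.

Lemma jet_of_ex_diff_n (U : R -> R -> Prop) (F : R -> R -> R) :
  open_2d U -> (forall s t, U s t -> ex_diff_n F 2 s t) ->
  C2_jet U F (dx F) (dy F) (dx (dx F)) (dy (dx F)) (dy (dy F)).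
Proof.
  intros HU HF.
  (* [ex_diff_n] treats the two mixed derivatives as unrelated functions; Schwarz's theorem merges
     them into the single [B] of the jet. *)
  assert (HS : forall s t, U s t -> dx (dy F) s t = dy (dx F) s t).
  { intros s t H. apply (Schwarz F s t).
    - eapply locally_2d_impl; [| apply HU, H].
      apply locally_2d_forall. intros u v Huv.
      destruct (HF u v Huv) as (_ & H1 & H2 & (_ & _ & H3 & _) & (_ & H4 & _)).
      repeat split; assumption.
    - now destruct (HF s t H) as (_ & _ & _ & _ & (_ & _ & _ & (H5 & _) & _)).
    - now destruct (HF s t H) as (_ & _ & _ & (_ & _ & _ & _ & (H5 & _)) & _). }
  split; try assumption; intros s t H;
    destruct (HF s t H) as (H0 & H1 & H2 & (H3 & H4 & H5 & (H6 & _) & (H7 & _)) &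
      (H8 & H9 & H10 & (H11 & _) & (H12 & _))).
  - now apply Derive_correct.
  - now apply (Derive_correct (fun v => F s v)).
  - now apply Derive_correct.
  - now apply (Derive_correct (fun v => dx F s v)).
  - rewrite <- HS by assumption. now apply (Derive_correct (fun u => dy F u t)).
  - now apply (Derive_correct (fun v => dy F s v)).
  - now apply continuity_2d_pt_continuous_2d.
  - now apply continuity_2d_pt_continuous_2d.
  - now apply continuity_2d_pt_continuous_2d.
Qed.

(* For c^2 + d^2 = 1 this change of variables is a reflection, hence its own
   inverse: it takes (x, y) to (s, t) as well as (s, t) to (x, y). *)
Definition reflect {T : Type} (c d : R) (F : R -> R -> T) (x y : R) : T :=
  F (c * x + d * y) (d * x - c * y).

Lemma reflect_involutive {T : Type} (c d : R) (F : R -> R -> T) (x y : R) :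
  c ^ 2 + d ^ 2 = 1 -> reflect c d (reflect c d F) x y = F x y.
Proof.
  intros H. unfold reflect. f_equal.
  - transitivity ((c ^ 2 + d ^ 2) * x); [ring | rewrite H; ring].
  - transitivity ((c ^ 2 + d ^ 2) * y); [ring | rewrite H; ring].
Qed.

Lemma open_2d_reflect (c d : R) (U : R -> R -> Prop) :
  open_2d U -> open_2d (reflect c d U).
Proof.
  intros HU x y H. destruct (HU _ _ H) as [e He].
  (* The [+ 1] keeps the denominator positive even for c = d = 0. *)
  assert (Hm : 0 < e / (Rabs c + Rabs d + 1)).
  { apply Rdiv_lt_0_compat; [apply e|].
    pose proof (Rabs_pos c). pose proof (Rabs_pos d). lra. }
  exists (mkposreal _ Hm). intros u v Hu Hv. simpl in Hu, Hv.
  assert (Hlin : forall p q, Rabs p + Rabs q = Rabs c + Rabs d ->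
            Rabs (p * (u - x) + q * (v - y)) < e).
  { intros p q Hpq. eapply Rle_lt_trans; [apply Rabs_triang|].
    rewrite !Rabs_mult.
    set (m := e / (Rabs c + Rabs d + 1)) in *.
    assert (Em : e = m * (Rabs c + Rabs d + 1) :> R).
    { unfold m. field. pose proof (Rabs_pos c). pose proof (Rabs_pos d). lra. }
    rewrite Em, <- Hpq. pose proof (Rabs_pos p). pose proof (Rabs_pos q).
    pose proof (Rabs_pos (u - x)). pose proof (Rabs_pos (v - y)). nra. }
  apply He.
  - replace (c * u + d * v - (c * x + d * y)) with (c * (u - x) + d * (v - y)) by ring.
    now apply Hlin.
  - replace (d * u - c * v - (d * x - c * y)) with (d * (u - x) + (- c) * (v - y)) by ring.
    apply Hlin. rewrite Rabs_Ropp. ring.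
Qed.

Lemma continuous_2d_reflect (c d : R) (F : R -> R -> R) (x y : R) :
  reflect c d (continuous_2d F) x y -> continuous_2d (reflect c d F) x y.
Proof.
  intros H. unfold continuous_2d, reflect.
  apply (continuous_comp_2 (fun p : R * R => c * fst p + d * snd p)
           (fun p : R * R => d * fst p - c * snd p) F).
  - apply (continuous_plus (fun p : R * R => c * fst p) (fun p : R * R => d * snd p)).
    + apply (continuous_scal_r c (fun p : R * R => fst p)), continuous_fst.
    + apply (continuous_scal_r d (fun p : R * R => snd p)), continuous_snd.
  - apply (continuous_minus (fun p : R * R => d * fst p) (fun p : R * R => c * snd p)).
    + apply (continuous_scal_r d (fun p : R * R => fst p)), continuous_fst.
    + apply (continuous_scal_r c (fun p : R * R => snd p)), continuous_snd.
  - exact H.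
Qed.

Lemma continuous_2d_lin (a b : R) (F G : R -> R -> R) (x y : R) :
  continuous_2d F x y -> continuous_2d G x y ->
  continuous_2d (fun s t => a * F s t + b * G s t) x y.
Proof.
  intros HF HG.
  apply (continuous_plus (fun p : R * R => a * F (fst p) (snd p)) (fun p : R * R => b * G (fst p) (snd p))).
  - now apply (continuous_scal_r a (fun p : R * R => F (fst p) (snd p))).
  - now apply (continuous_scal_r b (fun p : R * R => G (fst p) (snd p))).
Qed.

Lemma is_derive_reflect_x (c d : R) (U : R -> R -> Prop) (F P Q : R -> R -> R) (x y : R) :
  open_2d U ->
  (forall s t, U s t -> is_derive (fun u => F u t) s (P s t)) ->
  (forall s t, U s t -> is_derive (F s) t (Q s t)) ->
  (forall s t, U s t -> continuous_2d P s t) ->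
  reflect c d U x y ->
  is_derive (fun u => reflect c d F u y) x
    (reflect c d (fun s t => c * P s t + d * Q s t) x y).
Proof.
  intros HU HP HQ HPc H. unfold reflect.
  apply (is_derive_along U F P Q (fun u => c * u + d * y) (fun u => d * u - c * y));
    trivial.
  - now apply HPc.
  - auto_derive; [trivial | ring].
  - auto_derive; [trivial | ring].
Qed.

Lemma is_derive_reflect_y (c d : R) (U : R -> R -> Prop) (F P Q : R -> R -> R) (x y : R) :
  open_2d U ->
  (forall s t, U s t -> is_derive (fun u => F u t) s (P s t)) ->
  (forall s t, U s t -> is_derive (F s) t (Q s t)) ->
  (forall s t, U s t -> continuous_2d P s t) ->
  reflect c d U x y ->
  is_derive (fun v => reflect c d F x v) y
    (reflect c d (fun s t => d * P s t - c * Q s t) x y).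
Proof.
  intros HU HP HQ HPc H. unfold reflect.
  evar_last.
  - apply (is_derive_along U F P Q (fun v => c * x + d * v) (fun v => d * x - c * v)
      y d (- c)); trivial.
    + now apply HPc.
    + auto_derive; [trivial | ring].
    + auto_derive; [trivial | ring].
  - simpl. ring.
Qed.


(** The gradient is multiplied by the reflection matrix, and the Hessian is conjugated by it. *)
Lemma jet_reflect (c d : R) U F P Q A B C :
  C2_jet U F P Q A B C ->
  C2_jet (reflect c d U) (reflect c d F)
    (reflect c d (fun s t => c * P s t + d * Q s t))
    (reflect c d (fun s t => d * P s t - c * Q s t))
    (reflect c d (fun s t => c ^ 2 * A s t + 2 * c * d * B s t + d ^ 2 * C s t))
    (reflect c d (fun s t => c * d * A s t + (d ^ 2 - c ^ 2) * B s t - c * d * C s t))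
    (reflect c d (fun s t => d ^ 2 * A s t - 2 * c * d * B s t + c ^ 2 * C s t)).
Proof.
  intros J. destruct (J) as [HU HP HQ HA HPt HQs HC HAc HBc HCc].
  assert (HPc : forall s t, U s t -> continuous_2d P s t) by (intros; eapply jet_Pc; eassumption).
  assert (HQc : forall s t, U s t -> continuous_2d Q s t) by (intros; eapply jet_Qc; eassumption).
  assert (Hlin3 : forall a b e s t, U s t ->
    continuous_2d (fun s t => a * A s t + b * B s t + e * C s t) s t).
  { intros a b e s t H.
    apply (continuous_plus (fun p : R * R => a * A (fst p) (snd p) + b * B (fst p) (snd p))
      (fun p : R * R => e * C (fst p) (snd p))).
    - apply (continuous_2d_lin a b A B); auto.
    - apply (continuous_scal_r e (fun p : R * R => C (fst p) (snd p))). now apply HCc. }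
  assert (Hs : forall a b s t, U s t ->
    is_derive (fun u => a * P u t + b * Q u t) s (a * A s t + b * B s t)).
  { intros a b s t H. apply (is_derive_plus (V := R_NormedModule)); apply is_derive_scal; auto. }
  assert (Ht : forall a b s t, U s t ->
    is_derive (fun v => a * P s v + b * Q s v) t (a * B s t + b * C s t)).
  { intros a b s t H. apply (is_derive_plus (V := R_NormedModule) (fun v => a * P s v)
      (fun v => b * Q s v)); apply is_derive_scal; auto. }
  split.
  - now apply open_2d_reflect.
  - intros x y H. now apply (is_derive_reflect_x c d U F P Q).
  - intros x y H. now apply (is_derive_reflect_y c d U F P Q).
  - intros x y H. evar_last.
    + apply (is_derive_reflect_x c d U (fun s t => c * P s t + d * Q s t)
        (fun s t => c * A s t + d * B s t) (fun s t => c * B s t + d * C s t)); auto.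
      intros; apply continuous_2d_lin; auto.
    + unfold reflect. ring.
  - intros x y H. evar_last.
    + apply (is_derive_reflect_y c d U (fun s t => c * P s t + d * Q s t)
        (fun s t => c * A s t + d * B s t) (fun s t => c * B s t + d * C s t)); auto.
      intros; apply continuous_2d_lin; auto.
    + unfold reflect. ring.
  - intros x y H.
    apply (is_derive_ext (fun u => reflect c d (fun s t => d * P s t + (- c) * Q s t) u y));
      [intros; unfold reflect; simpl; ring|].
    evar_last.
    + apply (is_derive_reflect_x c d U (fun s t => d * P s t + (- c) * Q s t)
        (fun s t => d * A s t + (- c) * B s t) (fun s t => d * B s t + (- c) * C s t)); auto.
      intros; apply continuous_2d_lin; auto.
    + unfold reflect. ring.
  - intros x y H.
    apply (is_derive_ext (fun v => reflect c d (fun s t => d * P s t + (- c) * Q s t) x v));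
      [intros; unfold reflect; simpl; ring|].
    evar_last.
    + apply (is_derive_reflect_y c d U (fun s t => d * P s t + (- c) * Q s t)
        (fun s t => d * A s t + (- c) * B s t) (fun s t => d * B s t + (- c) * C s t)); auto.
      intros; apply continuous_2d_lin; auto.
    + unfold reflect. ring.
  - intros x y H. apply continuous_2d_reflect. now apply Hlin3.
  - intros x y H. apply continuous_2d_reflect.
    apply (continuous_ext (fun p : R * R => c * d * A (fst p) (snd p)
      + (d ^ 2 - c ^ 2) * B (fst p) (snd p) + (- (c * d)) * C (fst p) (snd p))).
    + intros; simpl; ring.
    + now apply Hlin3.
  - intros x y H. apply continuous_2d_reflect.
    apply (continuous_ext (fun p : R * R => d ^ 2 * A (fst p) (snd p)
      + (- (2 * c * d)) * B (fst p) (snd p) + c ^ 2 * C (fst p) (snd p))).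
    + intros; simpl; ring.
    + now apply Hlin3.
Qed.

(** * Principal directions of a graph *)

Definition area (p q : R) : R := sqrt (1 + p ^ 2 + q ^ 2).

Lemma area_pos (p q : R) : 0 < area p q.
Proof. apply sqrt_lt_R0. nra. Qed.

Lemma area_sqr (p q : R) : area p q ^ 2 = 1 + p ^ 2 + q ^ 2.
Proof. apply pow2_sqrt. nra. Qed.

Definition reflect_vec (c d : R) (v : R * R) : R * R :=
  (c * fst v + d * snd v, d * fst v - c * snd v).

Lemma reflect_vec_involutive (c d : R) (v : R * R) :
  c ^ 2 + d ^ 2 = 1 -> reflect_vec c d (reflect_vec c d v) = v.
Proof.
  intros H. destruct v as [a b]. unfold reflect_vec; simpl.
  replace (d * (d * 1)) with (d ^ 2) by ring.
  f_equal.
  - transitivity ((c ^ 2 + d ^ 2) * a); [ring | rewrite H; ring].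
  - transitivity ((c ^ 2 + d ^ 2) * b); [ring | rewrite H; ring].
Qed.

(* The equation (second form) v = k (first form) v for the graph of a function
   with first and second derivatives p, q, A, B, C, multiplied by the adjugate of
   the first form and by the area element. *)
Definition eigenvector (p q A B C : R) (v : R * R) (k : R) : Prop :=
  (1 + q ^ 2) * (A * fst v + B * snd v) - p * q * (B * fst v + C * snd v)
    = k * area p q ^ 3 * fst v /\
  (1 + p ^ 2) * (B * fst v + C * snd v) - p * q * (A * fst v + B * snd v)
    = k * area p q ^ 3 * snd v.

(** Because E G - F^2 = W^2 and the second form carries a factor 1 / W, multiplication by W^3 clears
    all denominators. *)
Lemma shape_operator_eigenvector (f : R -> R -> R) (x y : R) (v : R * R) (k : R) :
  shape_operator f x y v = (k * fst v, k * snd v) <->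
  eigenvector (dx f x y) (dy f x y) (dx (dx f) x y) (dy (dx f) x y) (dy (dy f) x y) v k.
Proof.
  unfold shape_operator, eigenvector. cbv zeta.
  set (p := dx f x y). set (q := dy f x y).
  set (A := dx (dx f) x y). set (B := dy (dx f) x y). set (C := dy (dy f) x y).
  destruct v as [a b]. cbn [fst snd].
  pose proof (area_pos p q) as HW. pose proof (area_sqr p q) as EW.
  fold (area p q).
  replace ((1 + p ^ 2) * (1 + q ^ 2) - (p * q) ^ 2) with (area p q ^ 2) by (rewrite EW; ring).
  set (W := area p q) in *.
  assert (H3 : 0 < W ^ 3) by (apply pow_lt; lra).
  match goal with |- (?l1, ?l2) = _ <-> ?m1 = _ /\ ?m2 = _ =>
    assert (E1 : l1 = m1 / W ^ 3) by (field; lra);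
    assert (E2 : l2 = m2 / W ^ 3) by (field; lra);
    rewrite E1, E2; generalize m1 as n1; generalize m2 as n2 end.
  intros n2 n1. split.
  - intros E. injection E as F1 F2. rewrite <- (Rmult_comm (W ^ 3)), !(Rmult_assoc (W ^ 3)), <- F1, <- F2. split; field; lra.
  - intros [-> ->]. f_equal; field; lra.
Qed.

(** The new pair of equations is the image of the old pair under the reflection, modulo d^2 = 1 -
    c^2; the area element is invariant. *)
Lemma eigenvector_reflect (c d p q A B C : R) (v : R * R) (k : R) :
  c ^ 2 + d ^ 2 = 1 ->
  eigenvector p q A B C v k ->
  eigenvector (c * p + d * q) (d * p - c * q)
    (c ^ 2 * A + 2 * c * d * B + d ^ 2 * C)
    (c * d * A + (d ^ 2 - c ^ 2) * B - c * d * C)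
    (d ^ 2 * A - 2 * c * d * B + c ^ 2 * C) (reflect_vec c d v) k.
Proof.
  intros H [E1 E2]. destruct v as [a b]. unfold eigenvector, reflect_vec in *. cbn [fst snd] in *.
  assert (Hd : d ^ 2 = 1 - c ^ 2) by lra.
  replace (area (c * p + d * q) (d * p - c * q)) with (area p q).
  2:{ unfold area. f_equal. ring [Hd]. }
  set (K := k * area p q ^ 3) in *.
  split.
  - transitivity (c * (K * a) + d * (K * b)); [| ring]. rewrite <- E1, <- E2. ring [Hd].
  - transitivity (d * (K * a) - c * (K * b)); [| ring]. rewrite <- E1, <- E2. ring [Hd].
Qed.

(** For the direction (1, 0) the right-hand side of the second equation vanishes, which gives the
    condition on B. Inserted into the first equation, it turns (1 + p^2)(1 + q^2) - p^2 q^2 into the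
    square of the area element. *)
Lemma eigenvector_e1 (p q A B C a k : R) :
  a <> 0 -> eigenvector p q A B C (a, 0) k ->
  (1 + p ^ 2) * B = p * q * A /\ A = k * (1 + p ^ 2) * area p q.
Proof.
  intros Ha [E1 E2]. cbn [fst snd] in *.
  pose proof (area_pos p q) as HW. pose proof (area_sqr p q) as EW.
  assert (EB : (1 + p ^ 2) * B = p * q * A) by (apply (Rmult_eq_reg_r a); lra).
  split; [exact EB|].
  assert (E3 : (1 + q ^ 2) * A - p * q * B = k * area p q ^ 3)
    by (apply (Rmult_eq_reg_r a); lra).
  apply (Rmult_eq_reg_l (area p q ^ 2)); [| nra].
  transitivity ((1 + p ^ 2) * ((1 + q ^ 2) * A - p * q * B)).
  - rewrite EW. transitivity ((1 + p ^ 2) * (1 + q ^ 2) * A - p * q * (p * q * A)); [ring|].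
    rewrite <- EB. ring.
  - rewrite E3. ring.
Qed.

Lemma e1_eigenvector (p q A B C k : R) :
  (1 + p ^ 2) * B = p * q * A -> A = k * (1 + p ^ 2) * area p q ->
  eigenvector p q A B C (1, 0) k.
Proof.
  intros EB EA. pose proof (area_sqr p q) as EW. split; cbn [fst snd].
  - apply (Rmult_eq_reg_l (1 + p ^ 2)); [| nra].
    transitivity ((1 + p ^ 2) * (1 + q ^ 2) * A - p * q * ((1 + p ^ 2) * B)); [ring|].
    rewrite EB. transitivity (area p q ^ 2 * A); [rewrite EW; ring|].
    rewrite EA. ring.
  - lra.
Qed.

(** Orthogonality to (1, 0) in the first fundamental form forces b to be nonzero. In the second
    equation the coefficient of a is (1 + p^2) B - p q A = 0, so that division by b leaves the
    curvature. *)
Lemma eigenvector_orthogonal (p q A B C a b k : R) :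
  (1 + p ^ 2) * B = p * q * A -> (a, b) <> (0, 0) ->
  (1 + p ^ 2) * a + p * q * b = 0 ->
  eigenvector p q A B C (a, b) k ->
  (1 + p ^ 2) * C - p * q * B = k * area p q ^ 3.
Proof.
  intros EB Hv Hab [_ E2]. cbn [fst snd] in *.
  assert (Hb : b <> 0).
  { intros ->. apply Hv. f_equal. apply (Rmult_eq_reg_l (1 + p ^ 2)); nra. }
  apply (Rmult_eq_reg_r b); [| assumption]. rewrite <- E2.
  transitivity (((1 + p ^ 2) * B - p * q * A) * a + ((1 + p ^ 2) * C - p * q * B) * b).
  - rewrite EB. ring.
  - ring.
Qed.

Lemma orthogonal_eigenvector (p q A B C k : R) :
  (1 + p ^ 2) * B = p * q * A ->
  (1 + p ^ 2) * C - p * q * B = k * area p q ^ 3 ->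
  eigenvector p q A B C (- (p * q), 1 + p ^ 2) k.
Proof.
  intros EB EC. split; cbn [fst snd].
  - transitivity ((1 + q ^ 2) * ((1 + p ^ 2) * B - p * q * A)
      - p * q * ((1 + p ^ 2) * C - p * q * B)); [ring|].
    rewrite EC, EB. ring.
  - transitivity ((1 + p ^ 2) * ((1 + p ^ 2) * C - p * q * B)
      - p * q * ((1 + p ^ 2) * B - (1 + p ^ 2) * B) - p * q * (p * q * A) * -1
      - p * q * ((1 + p ^ 2) * B)); [ring|].
    rewrite EC, EB. ring.
Qed.

(** * Profiles of prescribed curvature *)

(** Carathéodory's form of differentiability. Together with its converse [is_derive_of_quotient] it
    reduces implicit differentiation to algebra and continuity. *)
Lemma difference_quotient_extension (f : R -> R) (x l : R) :
  is_derive f x l ->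
  exists g : R -> R, continuous g x /\ g x = l /\ forall z, f z - f x = g z * (z - x).
Proof.
  intros H. apply is_derive_Reals in H.
  exists (fun z => if Req_EM_T z x then l else (f z - f x) / (z - x)).
  split; [| split].
  - apply continuity_pt_filterlim. intros e He.
    destruct (H e He) as [d Hd]. exists d; split; [apply d|].
    intros z [[_ Hz] Hd']. unfold Rdist in *. simpl in *. unfold Rdist in *.
    destruct (Req_EM_T x x) as [_|]; [| congruence].
    destruct (Req_EM_T z x) as [Ez|Ez]; [congruence|].
    assert (Hzx : z - x <> 0) by lra.
    pose proof (Hd (z - x) Hzx Hd') as Hq. now replace (x + (z - x)) with z in Hq by ring.
  - destruct (Req_EM_T x x); congruence.
  - intros z. destruct (Req_EM_T z x) as [->|Ez]; [ring | field; lra].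
Qed.

Lemma is_derive_of_quotient (f g : R -> R) (x : R) :
  continuous g x -> locally x (fun z => f z - f x = g z * (z - x)) ->
  is_derive f x (g x).
Proof.
  intros Hg [d1 H1]. apply is_derive_Reals. intros e He.
  destruct (Hg (ball (g x) e)) as [d2 H2].
  { exists (mkposreal e He). intros y Hy. exact Hy. }
  assert (Hd : 0 < Rmin d1 d2) by (apply Rmin_pos; [apply d1 | apply d2]).
  exists (mkposreal _ Hd). intros h Hh Hhd. simpl in Hhd.
  pose proof (Rmin_l d1 d2). pose proof (Rmin_r d1 d2).
  assert (Hb : forall d : posreal, Rabs h < d -> ball x d (x + h)).
  { intros d Hd'. change (Rabs (x + h - x) < d). now replace (x + h - x) with h by ring. }
  rewrite H1 by (apply Hb; lra).
  replace (g (x + h) * (x + h - x) / h) with (g (x + h)) by (field; assumption).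
  apply (H2 (x + h)), Hb. lra.
Qed.

(** Here [sigma] is assumed only continuous. Subtracting the equations at u and z gives (1 - b(u)
    gS(sigma u)) (sigma u - sigma z) = (a u - a z) + (b u - b z) S(sigma z), where gS is the
    quotient of S at sigma z. The first factor stays nonzero near z, so dividing by it yields a
    continuous quotient for [sigma]. *)
Lemma is_derive_implicit (S a b sigma : R -> R) (z da db kappa : R) :
  locally z (fun u => sigma u - b u * S (sigma u) = a u) ->
  continuous sigma z ->
  is_derive a z da -> is_derive b z db -> is_derive S (sigma z) kappa ->
  1 - b z * kappa <> 0 ->
  is_derive sigma z ((da + db * S (sigma z)) / (1 - b z * kappa)).
Proof.
  intros Heq Hs Ha Hb HS Hnz.
  assert (Hbc : continuous b z) by (apply (ex_derive_continuous b); now exists db).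
  destruct (difference_quotient_extension a z da Ha) as [ga [Cga [Ega Ha']]].
  destruct (difference_quotient_extension b z db Hb) as [gb [Cgb [Egb Hb']]].
  destruct (difference_quotient_extension S _ _ HS) as [gS [CgS [EgS HS']]].
  set (den := fun u => 1 - b u * gS (sigma u)).
  assert (Cden : continuous den z).
  { apply (continuous_minus (fun _ => 1) (fun u => b u * gS (sigma u))).
    - apply continuous_const.
    - apply (continuous_mult b (fun u => gS (sigma u))); [assumption|].
      now apply continuous_comp. }
  assert (Eden : den z = 1 - b z * kappa) by (unfold den; now rewrite EgS).
  set (g := fun u => (ga u + gb u * S (sigma z)) / den u).
  assert (Eg : (da + db * S (sigma z)) / (1 - b z * kappa) = g z)
    by (unfold g; now rewrite Eden, Ega, Egb).
  rewrite Eg. apply is_derive_of_quotient.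
  - apply (continuous_mult (fun u => ga u + gb u * S (sigma z)) (fun u => / den u)).
    + apply (continuous_plus ga (fun u => gb u * S (sigma z))); [assumption|].
      apply (continuous_mult gb (fun _ => S (sigma z))); [assumption|].
      apply continuous_const.
    + apply (continuous_comp den Rinv); [assumption|].
      apply continuous_Rinv. now rewrite Eden.
  - pose proof (locally_singleton _ _ Heq) as H0.
    assert (Hden : locally z (fun u => den u <> 0)).
    { apply (Cden (fun y => y <> 0)). apply (open_neq 0). now rewrite Eden. }
    generalize (filter_and _ _ Heq Hden). apply filter_imp. intros u [Hu Hdu].
    unfold g. apply (Rmult_eq_reg_l (den u)); [| assumption].
    transitivity ((a u - a z) + (b u - b z) * S (sigma z)).
    + rewrite <- Hu, <- H0. unfold den.
      replace (S (sigma u)) with (S (sigma z) + gS (sigma u) * (sigma u - sigma z))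
        by (rewrite <- HS'; ring). ring.
    + rewrite Ha', Hb'. field. assumption.
Qed.

(* A plane curve, the graph of G, of curvature kappa; S is the sine of its
   tangent angle. *)
Record profile (eps : R) (kappa S G : R -> R) : Prop := {
  profile_continuous : forall x, continuous kappa x;
  profile_curvature_bound : forall x, Rabs (kappa x) <= eps;
  profile_sine_0 : S 0 = 0;
  profile_is_derive_sine : forall x, is_derive S x (kappa x);
  profile_sine_bound : forall x, Rabs (S x) <= eps;
  profile_height_0 : G 0 = 0;
  profile_is_derive_height : forall x, is_derive G x (slope (S x))
}.

Lemma profile_exists (L eps : R) : 0 <= L -> 0 < eps < 1 ->
  exists delta, 0 < delta /\
  forall k : R -> R,
    continuous_on (fun x => Rabs x <= L) k ->
    (forall x, Rabs x <= L -> Rabs (k x) < delta) ->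
  exists kappa S G : R -> R,
    profile eps kappa S G /\ (forall x, Rabs x <= L -> kappa x = k x).
Proof.
  intros HL He. destruct (tangent_sine_exists L eps HL (proj1 He)) as [delta [Hd H]].
  exists delta. split; [assumption|]. intros k Hk Hb.
  destruct (H k Hk Hb) as (kappa & S & H1 & H2 & H3 & H4 & H5 & H6).
  destruct (primitive_exists (fun x => slope (S x))) as [G [G0 HG]].
  { intros x. apply (ex_derive_continuous (fun x => slope (S x))).
    eexists. apply (is_derive_comp slope S); [| apply H5].
    apply is_derive_slope. pose proof (H6 x). lra. }
  exists kappa, S, G. split; [| assumption]. split; assumption.
Qed.

Lemma profile_cosine_pos (eps : R) (kappa S G : R -> R) (x : R) :
  eps < 1 -> profile eps kappa S G -> 0 < cosine (S x).
Proof.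
  intros He H. apply cosine_pos. pose proof (profile_sine_bound _ _ _ _ H x). lra.
Qed.

Lemma profile_is_derive_slope (eps : R) (kappa S G : R -> R) (x : R) :
  eps < 1 -> profile eps kappa S G ->
  is_derive (fun x => slope (S x)) x (kappa x / cosine (S x) ^ 3).
Proof.
  intros He H. apply (is_derive_comp slope S); [| eapply profile_is_derive_sine, H].
  apply is_derive_slope. pose proof (profile_sine_bound _ _ _ _ H x). lra.
Qed.

Lemma profile_is_derive_cosine (eps : R) (kappa S G : R -> R) (x : R) :
  eps < 1 -> profile eps kappa S G ->
  is_derive (fun x => cosine (S x)) x (- (kappa x * slope (S x))).
Proof.
  intros He H. evar_last.
  - apply (is_derive_comp cosine S); [| eapply profile_is_derive_sine, H].
    apply is_derive_cosine. pose proof (profile_sine_bound _ _ _ _ H x). lra.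
  - unfold scal; simpl; unfold mult; simpl. ring.
Qed.

Lemma profile_is_derive_secant (eps : R) (kappa S G : R -> R) (x : R) :
  eps < 1 -> profile eps kappa S G ->
  is_derive (fun x => / cosine (S x)) x (S x * (kappa x / cosine (S x) ^ 3)).
Proof.
  intros He H. pose proof (profile_cosine_pos _ _ _ _ x He H). evar_last.
  - apply is_derive_inv; [now apply (profile_is_derive_cosine eps kappa S G)|]. simpl; lra.
  - unfold slope. simpl. field. lra.
Qed.

Lemma profile_sine_lipschitz (eps : R) (kappa S G : R -> R) (x y : R) :
  profile eps kappa S G -> Rabs (S x - S y) <= eps * Rabs (x - y).
Proof.
  intros H.
  destruct (MVT_gen S y x kappa) as [z [_ E]].
  - intros; eapply profile_is_derive_sine, H.
  - intros; eapply continuity_pt_of_is_derive, profile_is_derive_sine, H.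
  - rewrite E, Rabs_mult. apply Rmult_le_compat_r; [apply Rabs_pos | eapply profile_curvature_bound, H].
Qed.

Lemma profile_height_bound (eps : R) (kappa S G : R -> R) (x : R) :
  eps <= 1 / 2 -> profile eps kappa S G -> Rabs (G x) <= 2 * eps * Rabs x.
Proof.
  intros He H.
  destruct (MVT_gen G 0 x (fun x => slope (S x))) as [z [_ E]].
  - intros; eapply profile_is_derive_height, H.
  - intros; eapply continuity_pt_of_is_derive, profile_is_derive_height, H.
  - rewrite (profile_height_0 _ _ _ _ H), !Rminus_0_r in E. rewrite E, Rabs_mult.
    apply Rmult_le_compat_r; [apply Rabs_pos|].
    pose proof (profile_sine_bound _ _ _ _ H z) as Hz.
    assert (H1 : Rabs (S z) < 1) by lra.
    pose proof (cosine_pos _ H1). pose proof (cosine_sqr _ H1).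
    unfold slope, Rdiv. rewrite Rabs_mult, Rabs_inv, (Rabs_pos_eq (cosine _)) by lra.
    rewrite <- (pow2_abs (S z)) in *. pose proof (Rabs_pos (S z)).
    (* The squared cosine is at least 3/4; so dividing the sine by the cosine at most doubles it,
       whence the factor 2. *)
    assert (Hc : 1 / 2 <= cosine (S z)) by nra.
    apply (Rmult_le_reg_r (cosine (S z))); [lra|].
    rewrite Rmult_assoc, Rinv_l by lra. nra.
Qed.

(** * Moulding surfaces *)

(** [sigma s eta] is the abscissa of a point of the profile that the displacement by [eta] along the
    normal brings over s. As |eta S| <= 1/2, x - eta S x - s changes sign on [s - 1, s + 1].
    Clamping [eta] makes the root exist for all arguments, and [IVT] returns it as data, so that
    [sigma] is a function. *)
Lemma foot_exists (kappa S G : R -> R) :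
  profile (1 / 2) kappa S G ->
  exists sigma : R -> R -> R, forall s eta, Rabs eta <= 1 ->
    sigma s eta - eta * S (sigma s eta) = s.
Proof.
  intros H.
  assert (E : forall s eta, {x | x - clamp 1 eta * S x - s = 0}).
  { intros s eta.
    pose proof (clamp_bound 1 eta ltac:(lra)) as Hc.
    assert (Hp : forall x, Rabs (clamp 1 eta * S x) <= 1 / 2).
    { intros x. rewrite Rabs_mult. pose proof (profile_sine_bound _ _ _ _ H x).
      pose proof (Rabs_pos (S x)). pose proof (Rabs_pos (clamp 1 eta)). nra. }
    destruct (IVT (fun x => x - clamp 1 eta * S x - s) (s - 1) (s + 1)) as [x [_ Hx]].
    - intros x. apply (continuity_pt_of_is_derive _ _ (1 - clamp 1 eta * kappa x)).
      evar_last.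
      + apply (is_derive_minus (V := R_NormedModule) (fun x => x - clamp 1 eta * S x) (fun _ => s)).
        * apply (is_derive_minus (V := R_NormedModule) (fun x => x) (fun x => clamp 1 eta * S x)).
          -- apply is_derive_id.
          -- apply is_derive_scal. eapply profile_is_derive_sine, H.
        * apply is_derive_const.
      + unfold minus, plus, opp, zero, one; simpl. ring.
    - lra.
    - pose proof (Hp (s - 1)) as Hx. apply Rabs_le_between in Hx. lra.
    - pose proof (Hp (s + 1)) as Hx. apply Rabs_le_between in Hx. lra.
    - now exists x. }
  exists (fun s eta => proj1_sig (E s eta)). intros s eta He.
  destruct (E s eta) as [x Hx]. simpl. rewrite clamp_id in Hx by assumption. lra.
Qed.

(** The term eta1 (S x1 - S x2) is at most half of |x1 - x2| and is absorbed on the left. This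
    estimate supplies the continuity that implicit differentiation presupposes. *)
Lemma foot_lipschitz (kappa S G : R -> R) (x1 x2 s1 s2 eta1 eta2 : R) :
  profile (1 / 2) kappa S G -> Rabs eta1 <= 1 ->
  x1 - eta1 * S x1 = s1 -> x2 - eta2 * S x2 = s2 ->
  Rabs (x1 - x2) <= 2 * Rabs (s1 - s2) + Rabs (eta1 - eta2).
Proof.
  intros H He E1 E2.
  pose proof (profile_sine_lipschitz _ _ _ _ x1 x2 H) as HL.
  pose proof (profile_sine_bound _ _ _ _ H x2) as HB.
  assert (E : x1 - x2 = (s1 - s2) + (eta1 * (S x1 - S x2) + (eta1 - eta2) * S x2)) by lra.
  assert (Rabs (eta1 * (S x1 - S x2)) <= / 2 * Rabs (x1 - x2)).
  { rewrite Rabs_mult. pose proof (Rabs_pos eta1). pose proof (Rabs_pos (S x1 - S x2)). nra. }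
  assert (Rabs ((eta1 - eta2) * S x2) <= / 2 * Rabs (eta1 - eta2)).
  { rewrite Rabs_mult. pose proof (Rabs_pos (eta1 - eta2)). nra. }
  pose proof (Rabs_triang (s1 - s2) (eta1 * (S x1 - S x2) + (eta1 - eta2) * S x2)) as T1.
  pose proof (Rabs_triang (eta1 * (S x1 - S x2)) ((eta1 - eta2) * S x2)) as T2.
  rewrite <- E in T1. lra.
Qed.

Lemma continuous_2d_snd_comp (f : R -> R) (s t : R) :
  continuous f t -> continuous_2d (fun _ t => f t) s t.
Proof. intros H. apply (continuous_comp (@snd R R) f); [apply continuous_snd | exact H]. Qed.

Lemma continuous_2d_comp (f : R -> R) (F : R -> R -> R) (s t : R) :
  continuous_2d F s t -> continuous f (F s t) -> continuous_2d (fun s t => f (F s t)) s t.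
Proof. intros HF Hf. now apply (continuous_comp (fun p : R * R => F (fst p) (snd p)) f). Qed.

Lemma continuous_2d_mult (F G : R -> R -> R) (s t : R) :
  continuous_2d F s t -> continuous_2d G s t ->
  continuous_2d (fun s t => F s t * G s t) s t.
Proof.
  intros HF HG.
  now apply (continuous_mult (fun p : R * R => F (fst p) (snd p)) (fun p => G (fst p) (snd p))).
Qed.

(** There is no restriction on s, since the profile is controlled on the whole line; only the size
    of h t limits the surface. *)
Definition strip (T : R) (s t : R) : Prop := Rabs t < T.

Lemma open_strip (T : R) : open_2d (strip T).
Proof.
  intros s t H. unfold strip in *.
  assert (Hd : 0 < T - Rabs t) by lra.
  exists (mkposreal _ Hd). intros u v _ Hv. simpl in Hv.
  pose proof (Rabs_triang (v - t) t) as Ht. replace (v - t + t) with v in Ht by ring. lra.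
Qed.

Lemma continuous_2d_foot (kappa S G : R -> R) (sigma : R -> R -> R) (h : R -> R) (T s t : R) :
  profile (1 / 2) kappa S G ->
  (forall s eta, Rabs eta <= 1 -> sigma s eta - eta * S (sigma s eta) = s) ->
  (forall t, Rabs t < T -> Rabs (h t) <= 1) ->
  strip T s t -> continuous h t -> continuous_2d (fun s t => sigma s (h t)) s t.
Proof.
  intros H Hf Hh Hst Hc. apply continuity_2d_pt_continuous_2d. intros e.
  (* The Lipschitz estimate requires 2 (e / 4) + e / 2 = e. *)
  assert (He : 0 < e / 4) by (pose proof (cond_pos e); lra).
  assert (He2 : 0 < e / 2) by lra.
  destruct (Hc (ball (h t) (mkposreal _ He2))) as [d Hd].
  { exists (mkposreal _ He2). intros y Hy. exact Hy. }
  destruct (open_strip T s t Hst) as [d' Hd'].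
  assert (Hm : 0 < Rmin (e / 4) (Rmin d d')).
  { repeat apply Rmin_pos; [lra | apply d | apply d']. }
  exists (mkposreal _ Hm). intros u v Hu Hv. simpl in Hu, Hv.
  pose proof (Rmin_l (e / 4) (Rmin d d')). pose proof (Rmin_r (e / 4) (Rmin d d')).
  pose proof (Rmin_l d d'). pose proof (Rmin_r d d').
  assert (Huv : strip T u v) by (apply Hd'; lra).
  assert (Hhv : Rabs (h v - h t) < e / 2).
  { apply (Hd v). apply Rlt_le_trans with (1 := Hv). lra. }
  pose proof (foot_lipschitz kappa S G (sigma u (h v)) (sigma s (h t)) u s (h v) (h t) H
    (Hh v Huv) (Hf u (h v) (Hh v Huv)) (Hf s (h t) (Hh t Hst))) as HL.
  lra.
Qed.

Section moulding_surface.

Context (kappa S G k2 K h : R -> R) (sigma : R -> R -> R) (eps T : R).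
Context (HG : profile (1 / 2) kappa S G) (Hh : profile eps k2 K h).
Context (Heps : eps < 1) (Hhb : forall t, Rabs t < T -> Rabs (h t) <= 1).
Context (Hfoot : forall s eta, Rabs eta <= 1 -> sigma s eta - eta * S (sigma s eta) = s).

Let foot s t := sigma s (h t).

(* The profile z = G(s) is displaced by h(t) along its normal (-S, cosine S). *)
Definition moulding s t := G (foot s t) + h t * cosine (S (foot s t)).
Definition moulding_P s t := slope (S (foot s t)).
Definition moulding_Q s t := slope (K t) * / cosine (S (foot s t)).
(** kappa / (1 - h kappa) is the curvature of the parallel curve at distance h, and dividing by the
    cubed cosine turns curvature into a second derivative. *)
Definition moulding_A s t :=
  kappa (foot s t) / cosine (S (foot s t)) ^ 3 * / (1 - h t * kappa (foot s t)).
Definition moulding_B s t := moulding_A s t * (slope (K t) * S (foot s t)).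
Definition moulding_C s t :=
  k2 t / cosine (K t) ^ 3 * / cosine (S (foot s t)) +
  moulding_A s t * (slope (K t) * S (foot s t)) ^ 2.

Let h_continuous t : continuous h t.
Proof. apply (ex_derive_continuous h). eexists. eapply profile_is_derive_height, Hh. Qed.

Lemma foot_continuous s t : strip T s t -> continuous_2d foot s t.
Proof. intros H. apply (continuous_2d_foot kappa S G sigma h T s t HG Hfoot Hhb H (h_continuous t)). Qed.

(** The parallel curve has not reached a focal point, as |h| <= 1 and |kappa| <= 1/2. *)
Lemma foot_den_pos s t : strip T s t -> 0 < 1 - h t * kappa (foot s t).
Proof.
  intros H. pose proof (Hhb t H) as H1.
  pose proof (profile_curvature_bound _ _ _ _ HG (foot s t)) as H2.
  assert (H3 : Rabs (h t * kappa (foot s t)) <= 1 / 2).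
  { rewrite Rabs_mult. pose proof (Rabs_pos (h t)). pose proof (Rabs_pos (kappa (foot s t))). nra. }
  apply Rabs_le_between in H3. lra.
Qed.

Let cos_pos s t : 0 < cosine (S (foot s t)).
Proof. apply (profile_cosine_pos (1 / 2) kappa S G); [lra | exact HG]. Qed.

Lemma is_derive_foot_s s t : strip T s t ->
  is_derive (fun u => foot u t) s (/ (1 - h t * kappa (foot s t))).
Proof.
  intros H. pose proof (foot_den_pos s t H). evar_last.
  - apply (is_derive_implicit S (fun u => u) (fun _ => h t) (fun u => foot u t) s 1 0
      (kappa (foot s t))).
    + apply filter_forall. intros u. apply Hfoot, Hhb, H.
    + apply (continuous_comp (fun u => (u, t)) (fun p => foot (fst p) (snd p))).
      * apply (continuous_comp_2 (fun u : R => u) (fun _ : R => t) pair).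
        -- apply continuous_id.
        -- apply continuous_const.
        -- apply (continuous_ext (fun p : R * R => p)); [now intros [] | apply continuous_id].
      * now apply foot_continuous.
    + apply (is_derive_id s).
    + apply (is_derive_const (V := R_NormedModule) (h t) s).
    + eapply profile_is_derive_sine, HG.
    + lra.
  - simpl. field. lra.
Qed.

Lemma is_derive_foot_t s t : strip T s t ->
  is_derive (foot s) t (slope (K t) * S (foot s t) / (1 - h t * kappa (foot s t))).
Proof.
  intros H. pose proof (foot_den_pos s t H). evar_last.
  - apply (is_derive_implicit S (fun _ => s) h (foot s) t 0 (slope (K t))
      (kappa (foot s t))).
    + eapply filter_imp; [| exact (locally_2d_1d_const_x _ _ _ (open_strip T s t H))].
      intros u Hu. apply Hfoot, Hhb, Hu.
    + apply (continuous_comp (fun u => (s, u)) (fun p => foot (fst p) (snd p))).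
      * apply (continuous_comp_2 (fun _ : R => s) (fun u : R => u) pair).
        -- apply continuous_const.
        -- apply continuous_id.
        -- apply (continuous_ext (fun p : R * R => p)); [now intros [] | apply continuous_id].
      * now apply foot_continuous.
    + apply (is_derive_const (V := R_NormedModule) s t).
    + eapply profile_is_derive_height, Hh.
    + eapply profile_is_derive_sine, HG.
    + lra.
  - simpl. field. lra.
Qed.

Let dslope x : is_derive (fun x => slope (S x)) x (kappa x / cosine (S x) ^ 3).
Proof. apply (profile_is_derive_slope (1 / 2) kappa S G); [lra | exact HG]. Qed.
Let dcos x : is_derive (fun x => cosine (S x)) x (- (kappa x * slope (S x))).
Proof. apply (profile_is_derive_cosine (1 / 2) kappa S G); [lra | exact HG]. Qed.
Let dsec x : is_derive (fun x => / cosine (S x)) x (S x * (kappa x / cosine (S x) ^ 3)).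
Proof. apply (profile_is_derive_secant (1 / 2) kappa S G); [lra | exact HG]. Qed.
Let dK t : is_derive (fun t => slope (K t)) t (k2 t / cosine (K t) ^ 3).
Proof. now apply (profile_is_derive_slope eps k2 K h). Qed.

Let cont_of_derive (f : R -> R) x l : is_derive f x l -> continuous f x.
Proof. intros H. apply (ex_derive_continuous f). now exists l. Qed.

Let kappa_cos_continuous x : continuous (fun x => kappa x / cosine (S x) ^ 3) x.
Proof.
  assert (0 < cosine (S x)) by (apply (profile_cosine_pos (1 / 2) kappa S G); [lra | exact HG]).
  apply (continuous_mult kappa (fun x => / cosine (S x) ^ 3)).
  - eapply profile_continuous, HG.
  - apply (continuous_comp (fun x => cosine (S x)) (fun y => / y ^ 3)).
    + eapply cont_of_derive, dcos.
    + eapply cont_of_derive. auto_derive; [| reflexivity].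
      apply (pow_nonzero _ 3). lra.
Qed.

Let k2_cos_continuous t : continuous (fun t => k2 t / cosine (K t) ^ 3) t.
Proof.
  assert (0 < cosine (K t)) by now apply (profile_cosine_pos eps k2 K h).
  apply (continuous_mult k2 (fun x => / cosine (K x) ^ 3)).
  - eapply profile_continuous, Hh.
  - apply (continuous_comp (fun x => cosine (K x)) (fun y => / y ^ 3)).
    + eapply cont_of_derive. now apply (profile_is_derive_cosine eps k2 K h).
    + eapply cont_of_derive. auto_derive; [| reflexivity].
      apply (pow_nonzero _ 3). lra.
Qed.

Lemma moulding_A_continuous s t : strip T s t -> continuous_2d moulding_A s t.
Proof.
  intros H. pose proof (foot_continuous s t H) as Hf.
  apply (continuous_2d_mult (fun s t => kappa (foot s t) / cosine (S (foot s t)) ^ 3)).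
  - now apply (continuous_2d_comp (fun x => kappa x / cosine (S x) ^ 3) foot).
  - apply (continuous_2d_comp Rinv (fun s t => 1 - h t * kappa (foot s t))).
    + apply (continuous_minus (fun _ => 1) (fun p : R * R => h (snd p) * kappa (foot (fst p) (snd p)))).
      * apply continuous_const.
      * apply (continuous_2d_mult (fun _ t => h t) (fun s t => kappa (foot s t))).
        -- apply (continuous_2d_snd_comp h), h_continuous.
        -- apply (continuous_2d_comp kappa foot); [assumption | eapply profile_continuous, HG].
    + apply continuous_Rinv. pose proof (foot_den_pos s t H). lra.
Qed.

Let slope_K_S_continuous s t : strip T s t ->
  continuous_2d (fun s t => slope (K t) * S (foot s t)) s t.
Proof.
  intros H. apply (continuous_2d_mult (fun _ t => slope (K t)) (fun s t => S (foot s t))).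
  - apply (continuous_2d_snd_comp (fun t => slope (K t))). eapply cont_of_derive, dK.
  - apply (continuous_2d_comp S foot); [now apply foot_continuous|].
    eapply cont_of_derive, profile_is_derive_sine, HG.
Qed.

(** In the s-derivative of [moulding], the factor 1 - h kappa from G and the cosine cancels the
    denominator of the derivative of [foot]; in the t-derivative likewise. Hence [moulding_P] and
    [moulding_Q] contain [foot] but none of its derivatives. *)
Lemma moulding_jet :
  C2_jet (strip T) moulding moulding_P moulding_Q moulding_A moulding_B moulding_C.
Proof.
  split.
  - apply open_strip.
  - intros s t H. pose proof (foot_den_pos s t H). pose proof (cos_pos s t).
    pose proof (is_derive_foot_s s t H) as Df. unfold moulding. evar_last.
    + apply (is_derive_plus (V := R_NormedModule) (fun u => G (foot u t))
        (fun u => h t * cosine (S (foot u t)))).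
      * apply (is_derive_comp G (fun u => foot u t)); [eapply profile_is_derive_height, HG | exact Df].
      * apply is_derive_scal.
        apply (is_derive_comp (fun x => cosine (S x)) (fun u => foot u t)); [apply dcos | exact Df].
    + unfold moulding_P, plus, scal; simpl; unfold mult; simpl. unfold slope. field. lra.
  - intros s t H. pose proof (foot_den_pos s t H). pose proof (cos_pos s t).
    pose proof (is_derive_foot_t s t H) as Df. unfold moulding. evar_last.
    + apply (is_derive_plus (V := R_NormedModule) (fun u => G (foot s u))
        (fun u => h u * cosine (S (foot s u)))).
      * apply (is_derive_comp G (foot s)); [eapply profile_is_derive_height, HG | exact Df].
      * apply (is_derive_mult (K := R_AbsRing) h (fun u => cosine (S (foot s u))));
          [eapply profile_is_derive_height, Hh | | intros; apply Rmult_comm].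
        apply (is_derive_comp (fun x => cosine (S x)) (foot s)); [apply dcos | exact Df].
    + unfold moulding_Q, plus, scal; simpl; unfold mult; simpl.
      assert (HS1 : Rabs (S (foot s t)) < 1).
      { pose proof (profile_sine_bound _ _ _ _ HG (foot s t)). lra. }
      pose proof (cosine_sqr _ HS1) as E.
      (* The difference of the two sides is exhibited as a multiple of the Pythagorean relation,
         which [field] cannot use by itself. *)
      apply Rminus_diag_uniq. transitivity (slope (K t) *
        ((cosine (S (foot s t)) ^ 2 - (1 - S (foot s t) ^ 2)) / cosine (S (foot s t)))).
      * change (slope (S (foot s t))) with (S (foot s t) / cosine (S (foot s t))).
        generalize (slope (K t)). intros. field. lra.
      * rewrite E. unfold Rdiv. ring.
  - intros s t H. pose proof (foot_den_pos s t H). pose proof (cos_pos s t). evar_last.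
    + apply (is_derive_comp (fun x => slope (S x)) (fun u => foot u t));
        [apply dslope | now apply is_derive_foot_s].
    + unfold scal; simpl; unfold mult; simpl. unfold moulding_A. field. lra.
  - intros s t H. pose proof (foot_den_pos s t H). pose proof (cos_pos s t). evar_last.
    + apply (is_derive_comp (fun x => slope (S x)) (foot s));
        [apply dslope | now apply is_derive_foot_t].
    + unfold scal; simpl; unfold mult; simpl. unfold moulding_B, moulding_A. field. lra.
  - intros s t H. pose proof (foot_den_pos s t H). pose proof (cos_pos s t). evar_last.
    + apply is_derive_scal. apply (is_derive_comp (fun x => / cosine (S x)) (fun u => foot u t));
        [apply dsec | now apply is_derive_foot_s].
    + unfold scal; simpl; unfold mult; simpl. unfold moulding_B, moulding_A. field. lra.
  - intros s t H. pose proof (foot_den_pos s t H). pose proof (cos_pos s t). evar_last.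
    + apply (is_derive_mult (K := R_AbsRing) (fun t => slope (K t)) (fun u => / cosine (S (foot s u))));
        [apply dK | | intros; apply Rmult_comm].
      apply (is_derive_comp (fun x => / cosine (S x)) (foot s));
        [apply dsec | now apply is_derive_foot_t].
    + unfold plus, scal; simpl; unfold mult; simpl. unfold moulding_C, moulding_A.
      pose proof (profile_cosine_pos eps k2 K h t Heps Hh). field. lra.
  - apply moulding_A_continuous.
  - intros s t H. apply (continuous_2d_mult moulding_A (fun s t => slope (K t) * S (foot s t))).
    + now apply moulding_A_continuous.
    + now apply slope_K_S_continuous.
  - intros s t H.
    apply (continuous_plus
      (fun p : R * R => k2 (snd p) / cosine (K (snd p)) ^ 3 * / cosine (S (foot (fst p) (snd p))))
      (fun p : R * R => moulding_A (fst p) (snd p) * (slope (K (snd p)) * S (foot (fst p) (snd p))) ^ 2)).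
    + apply (continuous_2d_mult (fun _ t => k2 t / cosine (K t) ^ 3)
        (fun s t => / cosine (S (foot s t)))).
      * now apply (continuous_2d_snd_comp (fun t => k2 t / cosine (K t) ^ 3)).
      * apply (continuous_2d_comp (fun x => / cosine (S x)) foot); [now apply foot_continuous|].
        eapply cont_of_derive, dsec.
    + apply (continuous_2d_mult moulding_A (fun s t => (slope (K t) * S (foot s t)) ^ 2)).
      * now apply moulding_A_continuous.
      * apply (continuous_2d_comp (fun y => y ^ 2) (fun s t => slope (K t) * S (foot s t))).
        -- now apply slope_K_S_continuous.
        -- eapply cont_of_derive. auto_derive; [trivial | reflexivity].
Qed.

End moulding_surface.

(** * Curvatures and uniqueness of moulding surfaces *)

(** For these first derivatives, 1 + p^2 + q^2 factors as (1 + (slope u)^2)(1 + (slope v)^2). *)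
Lemma area_slopes (u v : R) : Rabs u < 1 -> Rabs v < 1 ->
  area (slope u) (slope v * / cosine u) = / (cosine u * cosine v).
Proof.
  intros Hu Hv. pose proof (cosine_pos u Hu). pose proof (cosine_pos v Hv).
  pose proof (sqrt_1_slope u Hu) as Eu. pose proof (sqrt_1_slope v Hv) as Ev.
  pose proof (sqrt_1_sqr_sqr (slope u)) as Su. pose proof (sqrt_1_sqr_sqr (slope v)) as Sv.
  rewrite Eu in Su. rewrite Ev in Sv.
  apply sqrt_lem_1.
  - nra.
  - left. apply Rinv_0_lt_compat, Rmult_lt_0_compat; assumption.
  - transitivity ((/ cosine u) ^ 2 * (/ cosine v) ^ 2); [field; lra|].
    rewrite Sv. transitivity ((/ cosine u) ^ 2 + (slope v * / cosine u) ^ 2); [ring|].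
    rewrite Su. reflexivity.
Qed.

Section moulding_curvatures.

Context (kappa S G k2 K h : R -> R) (sigma : R -> R -> R) (eps : R).
Context (HG : profile (1 / 2) kappa S G) (Hh : profile eps k2 K h).
Context (Heps : eps < 1)
  (Hfoot : forall s eta, Rabs eta <= 1 -> sigma s eta - eta * S (sigma s eta) = s).

Let P := moulding_P S h sigma.
Let Q := moulding_Q S K h sigma.
Let A := moulding_A kappa S h sigma.
Let B := moulding_B kappa S K h sigma.
Let C := moulding_C kappa S k2 K h sigma.

Let S_bound x : Rabs (S x) < 1.
Proof. pose proof (profile_sine_bound _ _ _ _ HG x). lra. Qed.

Let K_bound t : Rabs (K t) < 1.
Proof. pose proof (profile_sine_bound _ _ _ _ Hh t). lra. Qed.

Lemma moulding_area s t :
  area (P s t) (Q s t) = / (cosine (S (sigma s (h t))) * cosine (K t)).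
Proof. now apply area_slopes. Qed.

Let first_form s t : 1 + P s t ^ 2 = / cosine (S (sigma s (h t))) ^ 2.
Proof.
  rewrite <- (sqrt_1_sqr_sqr (P s t)). unfold P, moulding_P. rewrite sqrt_1_slope by trivial.
  field. pose proof (cosine_pos _ (S_bound (sigma s (h t)))). lra.
Qed.

Lemma moulding_PC s t : (1 + P s t ^ 2) * B s t = P s t * Q s t * A s t.
Proof.
  rewrite first_form. unfold P, Q, B, moulding_P, moulding_Q, moulding_B. fold A.
  unfold slope at 2. pose proof (cosine_pos _ (S_bound (sigma s (h t)))).
  generalize (slope (K t)) (A s t). intros. field. lra.
Qed.

(** The terms with [A] cancel, leaving k2 divided by the cubes of both cosines; so the second
    curvature is independent of s. *)
Lemma moulding_second_curvature s t :
  (1 + P s t ^ 2) * C s t - P s t * Q s t * B s t = k2 t * area (P s t) (Q s t) ^ 3.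
Proof.
  rewrite moulding_area, first_form.
  unfold P, Q, B, C, moulding_P, moulding_Q, moulding_B, moulding_C. fold A.
  unfold slope at 2. pose proof (cosine_pos _ (S_bound (sigma s (h t)))).
  pose proof (cosine_pos _ (K_bound t)).
  generalize (slope (K t)) (A s t). intros. field. lra.
Qed.

Lemma foot_0 s : sigma s (h 0) = s.
Proof.
  pose proof (profile_height_0 _ _ _ _ Hh) as H0. rewrite H0.
  pose proof (Hfoot s 0) as H. rewrite Rabs_R0 in H. specialize (H ltac:(lra)). lra.
Qed.

Lemma moulding_P_0 s : P s 0 = slope (S s).
Proof. unfold P, moulding_P. now rewrite foot_0. Qed.

Lemma moulding_Q_0 s : Q s 0 = 0.
Proof.
  unfold Q, moulding_Q. rewrite (profile_sine_0 _ _ _ _ Hh). unfold slope, Rdiv. ring.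
Qed.

Lemma moulding_first_curvature s :
  A s 0 = kappa s * (1 + P s 0 ^ 2) * area (P s 0) (Q s 0).
Proof.
  rewrite moulding_area, first_form, foot_0. unfold A, moulding_A. rewrite foot_0.
  rewrite (profile_height_0 _ _ _ _ Hh), (profile_sine_0 _ _ _ _ Hh).
  replace (cosine 0) with 1.
  - pose proof (cosine_pos _ (S_bound s)). field. lra.
  - unfold cosine. symmetry. apply sqrt_lem_1; lra.
Qed.

Lemma moulding_0 : moulding S G h sigma 0 0 = 0.
Proof.
  unfold moulding. rewrite foot_0.
  rewrite (profile_height_0 _ _ _ _ Hh), (profile_height_0 _ _ _ _ HG). ring.
Qed.

End moulding_curvatures.

(** Integrating factor exp(- E) with E' = m. Since m is controlled only on [-T, T], it is clamped
    before a primitive is taken. *)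
Lemma linear_ode_zero (w m : R -> R) (T : R) :
  (forall t, Rabs t <= T -> is_derive w t (m t * w t)) ->
  (forall t, Rabs t <= T -> continuity_pt m t) ->
  w 0 = 0 -> forall t, Rabs t <= T -> w t = 0.
Proof.
  intros Hw Hm w0 t Ht. pose proof (Rabs_pos t) as Ht0.
  destruct (primitive_exists (fun t => m (clamp T t))) as [E [_ HE]].
  { apply continuous_of_clamp; [lra|]. intros u Hu N HN.
    destruct (proj1 (continuity_pt_filterlim m u) (Hm u Hu) N HN) as [e He].
    exists e. intros y Hy _. now apply He. }
  assert (Hd : forall z, Rmin 0 t <= z <= Rmax 0 t ->
            is_derive (fun t => w t * exp (- E t)) z 0).
  { intros z Hz.
    assert (HzT : Rabs z <= T).
    { apply Rabs_le_between in Ht. revert Hz. unfold Rmin, Rmax.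
      destruct Rle_dec; intros; apply Rabs_le; lra. }
    evar_last.
    - apply (is_derive_mult (K := R_AbsRing) w (fun t => exp (- E t)));
        [now apply Hw | | intros; apply Rmult_comm].
      apply (is_derive_comp exp (fun t => - E t)); [apply is_derive_Reals, derivable_pt_lim_exp|].
      apply (is_derive_opp (V := R_NormedModule) E), HE.
    - rewrite clamp_id by assumption.
      unfold plus, scal, opp; simpl; unfold mult; simpl. ring. }
  enough (w t * exp (- E t) = w 0 * exp (- E 0)) as H.
  { rewrite w0, Rmult_0_l in H. apply Rmult_integral in H as [H | H]; [exact H|].
    pose proof (exp_pos (- E t)). lra. }
  apply (constant_of_derive (fun t => w t * exp (- E t))).
  - intros z Hz. apply Hd. lra.
  - intros z Hz. eapply continuity_pt_of_is_derive, Hd, Hz.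
Qed.

(** Used in both variables: in s the numerator is the expression that vanishes for a principal
    coordinate direction, in t it is the numerator of the second curvature. *)
Lemma is_derive_ratio (p q : R -> R) (z dp dq : R) :
  is_derive p z dp -> is_derive q z dq ->
  is_derive (fun u => q u / sqrt (1 + p u ^ 2)) z
    (((1 + p z ^ 2) * dq - p z * q z * dp) / sqrt (1 + p z ^ 2) ^ 3).
Proof.
  intros Hp Hq.
  pose proof (sqrt_1_sqr_pos (p z)) as Hw. pose proof (sqrt_1_sqr_sqr (p z)) as Ew.
  evar_last.
  - apply (is_derive_div q (fun u => sqrt (1 + p u ^ 2))); [exact Hq | | simpl in *; lra].
    apply (is_derive_comp sqrt (fun u => 1 + p u ^ 2) z (/ (2 * sqrt (1 + p z ^ 2))) (2 * p z * dp)).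
    + apply is_derive_Reals, derivable_pt_lim_sqrt. nra.
    + evar_last.
      * apply (is_derive_plus (V := R_NormedModule) (fun _ => 1) (fun u => p u ^ 2)).
        -- apply is_derive_const.
        -- apply is_derive_pow, Hp.
      * unfold plus, zero; simpl. ring.
  - unfold scal; simpl; unfold mult; simpl in *.
    set (w := sqrt (1 + p z * (p z * 1))) in *. rewrite <- Ew. field. lra.
Qed.

(** The open set U around the rectangle makes derivatives at its boundary two-sided. The second
    curvature is known for each t at a single s only, because gamma_2 is oblique in these
    coordinates. The characteristic starting at x must remain in the rectangle for all |t| <= T. *)
Lemma moulding_unique
    (kappa S G k2 K h : R -> R) (U : R -> R -> Prop) (F P Q A B C : R -> R -> R)
    (eps L T : R) :
  profile (1 / 2) kappa S G -> profile eps k2 K h -> eps < 1 -> 0 <= L -> 0 <= T ->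
  C2_jet U F P Q A B C ->
  (forall s t, Rabs s <= L -> Rabs t <= T -> U s t) ->
  (forall s t, Rabs s <= L -> Rabs t <= T -> (1 + P s t ^ 2) * B s t = P s t * Q s t * A s t) ->
  (forall t, Rabs t <= T -> exists s, Rabs s <= L /\
     (1 + P s t ^ 2) * C s t - P s t * Q s t * B s t = k2 t * area (P s t) (Q s t) ^ 3) ->
  (forall s, Rabs s <= L -> A s 0 = kappa s * (1 + P s 0 ^ 2) * area (P s 0) (Q s 0)) ->
  F 0 0 = 0 -> P 0 0 = 0 -> Q 0 0 = 0 ->
  forall x, (forall t, Rabs t <= T -> Rabs (x - h t * S x) <= L) ->
  forall t, Rabs t <= T -> F (x - h t * S x) t = G x + h t * cosine (S x).
Proof.
  intros HG Hh Heps HL HT J HU HPC HC HA F0 P0 Q0.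
  set (W := fun s t => sqrt (1 + P s t ^ 2)).
  assert (HW : forall s t, 0 < W s t) by (intros; apply sqrt_1_sqr_pos).
  assert (HW2 : forall s t, W s t ^ 2 = 1 + P s t ^ 2) by (intros; apply sqrt_1_sqr_sqr).
  assert (H0T : Rabs 0 <= T) by now rewrite Rabs_R0.
  assert (H0L : Rabs 0 <= L) by now rewrite Rabs_R0.
  assert (Hbetween : forall M z y, Rabs z <= M -> Rmin 0 z <= y <= Rmax 0 z -> Rabs y <= M).
  { intros M z y Hz. apply Rabs_le_between in Hz. unfold Rmin, Rmax.
    destruct Rle_dec; intros; apply Rabs_le; lra. }
  assert (Hconst : forall s t, Rabs s <= L -> Rabs t <= T -> Q s t / W s t = Q 0 t / W 0 t).
  { intros s t Hs Ht.
    assert (Hd : forall z, Rabs z <= L -> is_derive (fun s => Q s t / W s t) z 0).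
    { intros z Hz. evar_last.
      - apply (is_derive_ratio (fun s => P s t) (fun s => Q s t));
          [eapply jet_A | eapply jet_Qs]; try exact J; now apply HU.
      - simpl. fold (W z t).
        replace (1 + P z t * (P z t * 1)) with (1 + P z t ^ 2) by (simpl; ring).
        rewrite HPC by assumption. unfold Rdiv. ring. }
    apply (constant_of_derive (fun s => Q s t / W s t)).
    - intros z Hz. apply Hd, (Hbetween L s z Hs). lra.
    - intros z Hz. eapply continuity_pt_of_is_derive, Hd, (Hbetween L s z Hs). lra. }
  set (c := fun t => Q 0 t / W 0 t).
  assert (Harea : forall s t, Rabs s <= L -> Rabs t <= T ->
            area (P s t) (Q s t) = W s t * sqrt (1 + c t ^ 2)).
  { intros s t Hs Ht. unfold c. rewrite <- (Hconst s t Hs Ht).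
    unfold area. apply sqrt_lem_1.
    - nra.
    - apply Rmult_le_pos; [left; apply HW | apply sqrt_pos].
    - transitivity (W s t ^ 2 * sqrt (1 + (Q s t / W s t) ^ 2) ^ 2); [ring|].
      rewrite sqrt_1_sqr_sqr. pose proof (HW s t) as Hp.
      transitivity (W s t ^ 2 + Q s t ^ 2); [field; lra | rewrite HW2; ring]. }
  assert (Hdc : forall s t, Rabs s <= L -> Rabs t <= T ->
    is_derive (fun t => Q s t / W s t) t
      (((1 + P s t ^ 2) * C s t - P s t * Q s t * B s t) / W s t ^ 3)).
  { intros s t Hs Ht. apply (is_derive_ratio (P s) (Q s));
      [eapply jet_Pt | eapply jet_C]; try exact J; now apply HU. }
  assert (Ec : forall t, Rabs t <= T -> c t = slope (K t)).
  { intros t Ht. rewrite <- (slope_sine (c t)). f_equal.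
    apply (sine_determined k2 c K T); trivial.
    (* The derivative of c at z is computed on the line s = const that meets gamma_2 at height z.
       The ratios on both lines agree near z because |z| < T. *)
    - intros z Hz. assert (Hz' : Rabs z <= T) by lra.
      destruct (HC z Hz') as [s [Hs Es]].
      apply (is_derive_ext_loc (fun t => Q s t / W s t)).
      + eapply filter_imp; [| exact (locally_2d_1d_const_x _ _ _ (open_strip T 0 z Hz))].
        intros u Hu. apply Hconst; [assumption|]. unfold strip in Hu. lra.
      + evar_last; [now apply Hdc|]. rewrite Es, Harea by assumption.
        pose proof (HW s z). field. lra.
    - intros z Hz. eapply continuity_pt_of_is_derive, Hdc; assumption.
    - intros; eapply profile_is_derive_sine, Hh.
    - unfold c. rewrite Q0. unfold Rdiv. ring.
    - eapply profile_sine_0, Hh. }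
  assert (EQ : forall s t, Rabs s <= L -> Rabs t <= T -> Q s t = slope (K t) * W s t).
  { intros s t Hs Ht. rewrite <- Ec by assumption. unfold c.
    rewrite <- (Hconst s t Hs Ht). pose proof (HW s t). field. lra. }
  assert (K0 : slope (K 0) = 0).
  { rewrite (profile_sine_0 _ _ _ _ Hh). unfold slope, Rdiv. ring. }
  (* On t = 0 the ratio c vanishes, so the area element is W and the first curvature equation
     becomes A = kappa W^3, the equation of a plane curve. *)
  assert (EP : forall s, Rabs s <= L -> P s 0 = slope (S s)).
  { intros s Hs. rewrite <- (slope_sine (P s 0)). f_equal.
    apply (sine_determined kappa (fun s => P s 0) S L); trivial.
    - intros z Hz. assert (Hz' : Rabs z <= L) by lra.
      evar_last; [eapply jet_A; [exact J | now apply HU]|].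
      rewrite HA, Harea, Ec, K0 by assumption. fold (W z 0). rewrite <- HW2.
      replace (1 + 0 ^ 2) with 1 by ring. rewrite sqrt_1. ring.
    - intros z Hz. eapply continuity_pt_of_is_derive, jet_A; [exact J | now apply HU].
    - intros; eapply profile_is_derive_sine, HG.
    - eapply profile_sine_0, HG. }
  assert (EF : forall s, Rabs s <= L -> F s 0 = G s).
  { intros s Hs. enough (F s 0 - G s = F 0 0 - G 0) as E.
    { rewrite F0, (profile_height_0 _ _ _ _ HG) in E. lra. }
    assert (Hd : forall z, Rabs z <= L -> is_derive (fun s => F s 0 - G s) z 0).
    { intros z Hz. evar_last.
      - apply (is_derive_minus (V := R_NormedModule) (fun s => F s 0) G).
        + eapply jet_P; [exact J | now apply HU].
        + eapply profile_is_derive_height, HG.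
      - unfold minus, plus, opp; simpl. rewrite EP by assumption. ring. }
    apply (constant_of_derive (fun s => F s 0 - G s)).
    - intros z Hz. apply Hd, (Hbetween L s z Hs). lra.
    - intros z Hz. eapply continuity_pt_of_is_derive, Hd, (Hbetween L s z Hs). lra. }
  intros x Hx.
  assert (Sx : Rabs (S x) < 1) by (pose proof (profile_sine_bound _ _ _ _ HG x); lra).
  pose proof (cosine_pos _ Sx) as Cx. pose proof (cosine_sqr _ Sx) as Cx2.
  assert (Hx0 : x - h 0 * S x = x) by (rewrite (profile_height_0 _ _ _ _ Hh); ring).
  assert (HxL : Rabs x <= L) by (rewrite <- Hx0; now apply Hx).
  set (y := fun t => x - h t * S x).
  assert (Dy : forall t, is_derive y t (- (slope (K t) * S x))).
  { intros t. unfold y. evar_last.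
    - apply (is_derive_minus (V := R_NormedModule) (fun _ => x) (fun t => h t * S x)).
      + apply is_derive_const.
      + apply (is_derive_scal_l (K := R_AbsRing) (V := R_NormedModule) h t (slope (K t)) (S x)).
        eapply profile_is_derive_height, Hh.
    - unfold minus, plus, opp, zero, scal; simpl. unfold mult; simpl. ring. }
  assert (HUy : forall t, Rabs t <= T -> U (y t) t) by (intros; apply HU; [now apply Hx | assumption]).
  assert (HPc : forall s t, U s t -> continuous_2d P s t) by (intros; eapply jet_Pc; eassumption).
  assert (Hcurve : forall D : R -> R -> R, forall t, continuous_2d D (y t) t ->
            continuous (fun t => D (y t) t) t).
  { intros D t HD. apply (continuous_comp_2 y (fun t => t) D); [| apply continuous_id | exact HD].
    apply (ex_derive_continuous y). eexists; apply Dy. }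
  (* The condition on B reads B = sine(P) slope(K) A. Along y the derivative of P is therefore
     slope(K) A (sine(P) - S x), so that w = sine(P) - S x solves a linear homogeneous equation with
     w(0) = 0. *)
  assert (Pconst : forall t, Rabs t <= T -> sine (P (y t) t) - S x = 0).
  { apply (linear_ode_zero (fun t => sine (P (y t) t) - S x)
      (fun t => slope (K t) * (A (y t) t * / W (y t) t ^ 3))).
    - intros t Ht. evar_last.
      + apply (is_derive_minus (V := R_NormedModule) (fun t => sine (P (y t) t)) (fun _ => S x)).
        * apply (is_derive_comp sine (fun t => P (y t) t)); [apply is_derive_sine|].
          apply (is_derive_along U P A B y (fun t => t) t (- (slope (K t) * S x)) 1); try apply J; auto.
          apply (is_derive_id t).
        * apply is_derive_const.
      + unfold minus, plus, opp, zero, scal; simpl. unfold mult; simpl.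
        assert (EB : B (y t) t = P (y t) t * (slope (K t) * W (y t) t) * A (y t) t * / W (y t) t ^ 2).
        { rewrite <- EQ, <- HPC by (try apply Hx; assumption). rewrite HW2.
          field. rewrite <- HW2. pose proof (HW (y t) t). nra. }
        rewrite EB. unfold sine. simpl. fold (W (y t) t).
        replace (1 + P (y t) t * (P (y t) t * 1)) with (1 + P (y t) t ^ 2) by (simpl; ring).
        fold (W (y t) t). pose proof (HW (y t) t).
        generalize (slope (K t)). intros. field. lra.
    - intros t Ht. apply continuity_pt_filterlim.
      apply (continuous_mult (fun t => slope (K t)) (fun t => A (y t) t * / W (y t) t ^ 3)).
      + apply (ex_derive_continuous (fun t => slope (K t))). eexists.
        now apply (profile_is_derive_slope eps k2 K h).
      + apply (continuous_mult (fun t => A (y t) t) (fun t => / W (y t) t ^ 3)).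
        * apply Hcurve. eapply jet_Ac; [exact J | now apply HUy].
        * apply (continuous_comp (fun t => P (y t) t) (fun p => / sqrt (1 + p ^ 2) ^ 3)).
          -- apply Hcurve, HPc, HUy, Ht.
          -- apply (ex_derive_continuous (fun p => / sqrt (1 + p ^ 2) ^ 3)).
             pose proof (sqrt_1_sqr_pos (P (y t) t)). auto_derive.
             split; [nra | split; [| trivial]].
             simpl in *. apply (pow_nonzero _ 3). lra.
    - unfold y. rewrite Hx0, EP, sine_slope by assumption. ring. }
  assert (EPy : forall t, Rabs t <= T -> P (y t) t = slope (S x)).
  { intros t Ht. rewrite <- (slope_sine (P _ _)). f_equal. pose proof (Pconst t Ht). lra. }
  intros t Ht. change (F (y t) t = G x + h t * cosine (S x)).
  (* With P and Q known along y, the derivative of F there is slope(K) (1 - (S x)^2) / cosine(S x) =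
     h' cosine(S x). *)
  enough (F (y t) t - h t * cosine (S x) = F (y 0) 0 - h 0 * cosine (S x)) as E.
  { unfold y in E at 2. rewrite Hx0, EF, (profile_height_0 _ _ _ _ Hh) in E by assumption. lra. }
  assert (Hd : forall z, Rabs z <= T -> is_derive (fun t => F (y t) t - h t * cosine (S x)) z 0).
  { intros z Hz. evar_last.
    - apply (is_derive_minus (V := R_NormedModule) (fun t => F (y t) t) (fun t => h t * cosine (S x))).
      + apply (is_derive_along U F P Q y (fun t => t) z (- (slope (K z) * S x)) 1); try apply J; auto.
        apply (is_derive_id z).
      + apply (is_derive_scal_l (K := R_AbsRing) (V := R_NormedModule) h z (slope (K z)) (cosine (S x))).
        eapply profile_is_derive_height, Hh.
    - unfold minus, plus, opp, scal; simpl. unfold mult; simpl.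
      rewrite EQ by (try apply Hx; assumption). unfold W. rewrite EPy by assumption.
      rewrite sqrt_1_slope by assumption. unfold slope at 2.
      apply Rminus_diag_uniq.
      transitivity (slope (K z) * ((1 - S x ^ 2) - cosine (S x) ^ 2) / cosine (S x)).
      + generalize (slope (K z)). intros. field. lra.
      + rewrite Cx2. unfold Rdiv. ring. }
  apply (constant_of_derive (fun t => F (y t) t - h t * cosine (S x))).
  - intros z Hz. apply Hd, (Hbetween T t z Ht). lra.
  - intros z Hz. eapply continuity_pt_of_is_derive, Hd, (Hbetween T t z Ht). lra.
Qed.

(** * Reduction to the rotated coordinates *)

Lemma continuous_on_of_C1_on (D : R -> Prop) (k : R -> R) : C1_on D k -> continuous_on D k.
Proof.
  intros [dk [_ H]] u Hu.
  apply (filterdiff_continuous_aux (F := within D (locally u)) k).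
  - eexists. now apply H.
  - intros N HN. unfold within. eapply filter_imp; [| exact HN]. tauto.
Qed.

Lemma continuous_on_scale (m L : R) (D : R -> Prop) (k : R -> R) :
  (forall x, Rabs x <= L -> D (m * x)) -> continuous_on D k ->
  continuous_on (fun x => Rabs x <= L) (fun x => k (m * x)).
Proof.
  intros HD Hk x Hx N HN.
  assert (Hc : continuous (fun x => m * x) x).
  { apply (ex_derive_continuous (fun x : R => m * x)). auto_derive; trivial. }
  pose proof (Hk (m * x) (HD x Hx) N HN) as H.
  specialize (Hc _ H). unfold within, filtermap in *.
  eapply filter_imp; [| exact Hc]. intros y Hy Hyl. apply Hy. now apply HD.
Qed.

Lemma open_2d_locally_2d (D : R -> R -> Prop) : open_2d (locally_2d D).
Proof.
  intros x y [e He].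
  assert (He2 : 0 < e / 2) by (pose proof (cond_pos e); lra).
  exists (mkposreal _ He2). intros u v Hu Hv. exists (mkposreal _ He2).
  intros u' v' Hu' Hv'. simpl in *. apply He.
  - replace (u' - x) with ((u' - u) + (u - x)) by ring.
    eapply Rle_lt_trans; [apply Rabs_triang | lra].
  - replace (v' - y) with ((v' - v) + (v - y)) by ring.
    eapply Rle_lt_trans; [apply Rabs_triang | lra].
Qed.

Lemma principal_reflect_eigenvector (c d : R) (f : R -> R -> R) (x y : R) (v : R * R) (k : R) :
  c ^ 2 + d ^ 2 = 1 -> principal f x y v k ->
  eigenvector (c * dx f x y + d * dy f x y) (d * dx f x y - c * dy f x y)
    (c ^ 2 * dx (dx f) x y + 2 * c * d * dy (dx f) x y + d ^ 2 * dy (dy f) x y)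
    (c * d * dx (dx f) x y + (d ^ 2 - c ^ 2) * dy (dx f) x y - c * d * dy (dy f) x y)
    (d ^ 2 * dx (dx f) x y - 2 * c * d * dy (dx f) x y + c ^ 2 * dy (dy f) x y)
    (reflect_vec c d v) k.
Proof.
  intros H [_ E]. apply eigenvector_reflect; [assumption|].
  now apply shape_operator_eigenvector.
Qed.

Lemma reflect_vec_neq_0 (c d : R) (v : R * R) :
  c ^ 2 + d ^ 2 = 1 -> v <> (0, 0) -> reflect_vec c d v <> (0, 0).
Proof.
  intros H Hv E. apply Hv. rewrite <- (reflect_vec_involutive c d v H), E.
  unfold reflect_vec; simpl. f_equal; ring.
Qed.

(** Both sides are the first fundamental form of the graph, in the two coordinate systems. *)
Lemma tangent_dot_reflect (c d p q a b a' b' : R) :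
  c ^ 2 + d ^ 2 = 1 ->
  (c * a + d * b) * (c * a' + d * b') + (d * a - c * b) * (d * a' - c * b')
  + ((c * a + d * b) * (c * p + d * q) + (d * a - c * b) * (d * p - c * q))
    * ((c * a' + d * b') * (c * p + d * q) + (d * a' - c * b') * (d * p - c * q))
  = a * a' + b * b' + (a * p + b * q) * (a' * p + b' * q).
Proof.
  intros H. assert (Hd : d ^ 2 = 1 - c ^ 2) by lra. ring [Hd].
Qed.

(** (c, d) is the unit vector along gamma_1 and (d, -c) the one along e_1 - alpha e_2. In the
    reflected coordinates gamma_1 is t = 0 with parameter u = d s, and gamma_2 is s = c x, t = d
    x. *)
Section frame.

Context (alpha c d : R) (Halpha : 0 < alpha) (Hd : 0 < d) (Hc : c = alpha * d)
  (Hcd : c ^ 2 + d ^ 2 = 1).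

Lemma Pi_reflect (a x y : R) :
  Pi alpha a x y <-> Rabs (c * x + d * y) <= c * a /\ Rabs (d * x - c * y) <= d * a.
Proof.
  unfold Pi.
  replace (c * x + d * y) with (d * (alpha * x + y)) by (rewrite Hc; ring).
  replace (d * x - c * y) with (d * (x - alpha * y)) by (rewrite Hc; ring).
  rewrite !Rabs_mult, (Rabs_pos_eq d) by lra. subst c.
  split; intros [H1 H2]; split; nra.
Qed.

Lemma moulding_PC_solution (a1 a : R) (kt k2 kappa S G k2e K h : R -> R)
    (sigma : R -> R -> R) (eps T : R) :
  profile (1 / 2) kappa S G -> profile eps k2e K h -> eps < 1 ->
  (forall t, Rabs t < T -> Rabs (h t) <= 1) ->
  (forall s eta, Rabs eta <= 1 -> sigma s eta - eta * S (sigma s eta) = s) ->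
  0 < a -> d * a < T ->
  (forall u, gamma1_dom alpha a1 u -> kappa (u / d) = kt u) ->
  (forall x, gamma2_dom a1 x -> k2e (d * x) = k2 x) ->
  PC_solution alpha a1 kt k2 a (reflect c d (moulding S G h sigma)).
Proof.
  intros HG Hh Heps Hhb Hfoot Ha HaT Hkt Hk2.
  set (f := reflect c d (moulding S G h sigma)).
  pose proof (jet_reflect c d _ _ _ _ _ _ _
    (moulding_jet kappa S G k2e K h sigma eps T HG Hh Heps Hhb Hfoot)) as J.
  assert (HU : forall x y, Pi alpha a x y -> reflect c d (strip T) x y).
  { intros x y H. apply Pi_reflect in H. unfold reflect, strip. lra. }
  set (P := fun x y => reflect c d (moulding_P S h sigma) x y).
  set (Q := fun x y => reflect c d (moulding_Q S K h sigma) x y).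
  set (A := fun x y => reflect c d (moulding_A kappa S h sigma) x y).
  set (B := fun x y => reflect c d (moulding_B kappa S K h sigma) x y).
  set (C := fun x y => reflect c d (moulding_C kappa S k2e K h sigma) x y).
  assert (HP : forall x y, Pi alpha a x y ->
    dx f x y = c * P x y + d * Q x y /\ dy f x y = d * P x y - c * Q x y /\
    dx (dx f) x y = c ^ 2 * A x y + 2 * c * d * B x y + d ^ 2 * C x y /\
    dy (dx f) x y = c * d * A x y + (d ^ 2 - c ^ 2) * B x y - c * d * C x y /\
    dy (dy f) x y = d ^ 2 * A x y - 2 * c * d * B x y + c ^ 2 * C x y).
  { intros x y H. apply (jet_values _ _ _ _ _ _ _ x y J), HU, H. }
  assert (Hprin : forall x y v k, Pi alpha a x y -> v <> (0, 0) ->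
    eigenvector (P x y) (Q x y) (A x y) (B x y) (C x y) v k ->
    principal f x y (reflect_vec c d v) k).
  { intros x y v k H Hv He. split; [now apply reflect_vec_neq_0|].
    apply shape_operator_eigenvector.
    destruct (HP x y H) as (-> & -> & -> & -> & ->).
    now apply eigenvector_reflect. }
  assert (HPC : forall x y, (1 + P x y ^ 2) * B x y = P x y * Q x y * A x y).
  { intros x y. apply (moulding_PC kappa S G K h sigma HG). }
  set (e1 := (1, 0) : R * R).
  (* In the coordinates (s, t), this vector is orthogonal to (1, 0) for the first fundamental
     form. *)
  set (e2 := fun x y => (- (P x y * Q x y), 1 + P x y ^ 2) : R * R).
  assert (He1 : e1 <> (0, 0)) by (intros E; injection E; lra).
  assert (He2 : forall x y, e2 x y <> (0, 0)).
  { intros x y E. injection E. intros. pose proof (pow2_ge_0 (P x y)). simpl in *; lra. }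
  assert (Hd1 : forall x y, Pi alpha a x y ->
    principal f x y (reflect_vec c d e1) (A x y / ((1 + P x y ^ 2) * area (P x y) (Q x y)))).
  { intros x y H. apply Hprin; trivial. apply e1_eigenvector; [apply HPC|].
    pose proof (area_pos (P x y) (Q x y)). field. split; nra. }
  assert (Hd2 : forall x y, Pi alpha a x y ->
    principal f x y (reflect_vec c d (e2 x y)) (k2e (d * x - c * y))).
  { intros x y H. apply Hprin; trivial. apply orthogonal_eigenvector; [apply HPC|].
    exact (moulding_second_curvature kappa S G k2e K h sigma eps HG Hh Heps _ _). }
  assert (Hdot : forall x y v, dot3 (tangent_vec f x y (reflect_vec c d e1)) (1, - alpha, v)
      = v * (snd (tangent_vec f x y (reflect_vec c d e1)))).
  { intros x y v. unfold tangent_vec, reflect_vec, e1; simpl. rewrite Hc. ring. }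
  assert (H00 : Pi alpha a 0 0) by (apply Pi_reflect; rewrite !Rmult_0_r, Rminus_0_r, Rplus_0_r, Rabs_R0;
    assert (0 < c) by (rewrite Hc; nra); split; nra).
  assert (P00 : P 0 0 = 0 /\ Q 0 0 = 0).
  { unfold P, Q, reflect. replace (d * 0 - c * 0) with 0 by ring.
    replace (c * 0 + d * 0) with 0 by ring. split.
    - rewrite (moulding_P_0 S k2e K h sigma eps Hh) by assumption.
      rewrite (profile_sine_0 _ _ _ _ HG). unfold slope, Rdiv; ring.
    - now apply (moulding_Q_0 S k2e K h sigma eps). }
  split; [| split; [| split; [| split; [| split]]]].
  - intros x y H. pose proof (HU x y H) as Hxy.
    eapply locally_2d_impl; [| apply (jet_open _ _ _ _ _ _ _ J), Hxy].
    apply locally_2d_forall. intros u v Huv. exact (jet_ex_diff_n _ _ _ _ _ _ _ u v J Huv).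
  - unfold f, reflect. replace (d * 0 - c * 0) with 0 by ring.
    replace (c * 0 + d * 0) with 0 by ring.
    now apply (moulding_0 kappa S G k2e K h sigma eps).
  - rewrite (proj1 (HP 0 0 H00)). destruct P00 as [-> ->]. ring.
  - rewrite (proj1 (proj2 (HP 0 0 H00))). destruct P00 as [-> ->]. ring.
  (* The plane is the vertical plane through gamma_1; its parallel planes t = const cut out the
     sections, whose tangents are the direction [d1]. *)
  - exists (Plane (d, - c, 0) 0). split.
    + simpl. rewrite <- Hcd. ring.
    + intros x y H. exists (reflect_vec c d e1). split; [eexists; now apply Hd1|].
      eexists. split.
      * simpl. rewrite Rplus_0_l. reflexivity.
      * unfold parallel_normal, tangent_vec, reflect_vec, e1; simpl. ring.
  - exists (fun _ _ => reflect_vec c d e1), (fun x y => reflect_vec c d (e2 x y)).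
    split; [| split; [| split]].
    + intros x y H. split; [eexists; now apply Hd1|]. split; [eexists; now apply Hd2|].
      destruct (HP x y H) as (Ex & Ey & _). unfold tangent_vec. rewrite Ex, Ey.
      unfold dot3, reflect_vec. cbn [fst snd].
      rewrite tangent_dot_reflect by assumption. unfold e1, e2. cbn [fst snd]. ring.
    + intros x y H. rewrite Hdot. ring.
    + intros u Hu H.
      assert (Et : d * (alpha * u) - c * u = 0) by (rewrite Hc; ring).
      assert (Es : c * (alpha * u) + d * u = u / d).
      { apply (Rmult_eq_reg_r d); [| lra].
        transitivity ((c ^ 2 + d ^ 2) * u); [rewrite Hc; ring | rewrite Hcd; field; lra]. }
      apply Hprin; trivial. apply e1_eigenvector; [apply HPC|].
      rewrite <- Hkt by assumption. unfold A, P, Q, reflect. rewrite Et, Es.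
      apply (moulding_first_curvature kappa S G k2e K h sigma eps); assumption.
    + intros x Hx H. rewrite <- Hk2 by assumption.
      replace (d * x) with (d * x - c * 0) by ring. now apply Hd2.
Qed.

Lemma PC_solution_moulding (a1 a : R) (kt k2 kappa S G k2e K h : R -> R)
    (eps : R) (g : R -> R -> R) :
  profile (1 / 2) kappa S G -> profile eps k2e K h -> eps < 1 -> 0 < a <= a1 ->
  (forall u, gamma1_dom alpha a1 u -> kappa (u / d) = kt u) ->
  (forall x, gamma2_dom a1 x -> k2e (d * x) = k2 x) ->
  PC_solution alpha a1 kt k2 a g ->
  forall x, (forall t, Rabs t <= d * a -> Rabs (x - h t * S x) <= c * a) ->
  forall t, Rabs t <= d * a ->
    reflect c d g (x - h t * S x) t = G x + h t * cosine (S x).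
Proof.
  intros HG Hh Heps Ha Hkt Hk2 (HC2 & g0 & gx0 & gy0 & _ & d1 & d2 & Hframe & Hd1 & Hk1 & Hkk2).
  assert (Hc0 : 0 < c) by (subst c; nra).
  (* The points having a neighbourhood where g is C^2 form an open set, which contains Pi(a) by
     [C2_on]. *)
  set (U := fun x y => locally_2d (fun u v => ex_diff_n g 2 u v) x y).
  assert (HU : open_2d U) by apply open_2d_locally_2d.
  assert (J0 : C2_jet U g (dx g) (dy g) (dx (dx g)) (dy (dx g)) (dy (dy g))).
  { apply jet_of_ex_diff_n; [exact HU|]. intros x y H. exact (locally_2d_singleton _ _ _ H). }
  pose proof (jet_reflect c d _ _ _ _ _ _ _ J0) as J.
  assert (HPi : forall s t, Rabs s <= c * a -> Rabs t <= d * a -> reflect c d (Pi alpha a) s t).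
  { intros s t Hs Ht. unfold reflect. apply Pi_reflect.
    assert (Hd2' : d ^ 2 = 1 - c ^ 2) by lra.
    replace (c * (c * s + d * t) + d * (d * s - c * t)) with s by ring [Hd2'].
    replace (d * (c * s + d * t) - c * (d * s - c * t)) with t by ring [Hd2'].
    now split. }
  (* The third component of e_1 - alpha e_2 is 0, so orthogonality to it constrains only the
     projection of [d1], which must be a nonzero multiple of the s-direction. *)
  assert (Hdir : forall v : R * R, fst v = alpha * snd v -> v <> (0, 0) ->
     exists m, m <> 0 /\ reflect_vec c d v = (m, 0)).
  { intros [v1 v2] E Hv. simpl in E. subst v1. exists (v2 / d). split.
    - intros E. apply Hv. assert (E2 : v2 = 0).
      { replace v2 with (v2 / d * d) by (field; lra). rewrite E. ring. }
      rewrite E2. f_equal. ring.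
    - unfold reflect_vec; simpl. f_equal; [| rewrite Hc; ring].
      apply (Rmult_eq_reg_r d); [| lra].
      transitivity ((c ^ 2 + d ^ 2) * v2); [rewrite Hc; ring | rewrite Hcd; field; lra]. }
  assert (Hdir1 : forall x y, Pi alpha a x y -> fst (d1 x y) = alpha * snd (d1 x y)).
  { intros x y H. pose proof (Hd1 x y H) as E. unfold dot3, tangent_vec in E. lra. }
  set (p := fun x y => c * dx g x y + d * dy g x y).
  set (q := fun x y => d * dx g x y - c * dy g x y).
  set (A := fun x y => c ^ 2 * dx (dx g) x y + 2 * c * d * dy (dx g) x y + d ^ 2 * dy (dy g) x y).
  set (B := fun x y => c * d * dx (dx g) x y + (d ^ 2 - c ^ 2) * dy (dx g) x y
                       - c * d * dy (dy g) x y).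
  assert (HPC : forall x y k, Pi alpha a x y -> principal g x y (d1 x y) k ->
    (1 + p x y ^ 2) * B x y = p x y * q x y * A x y /\
    A x y = k * (1 + p x y ^ 2) * area (p x y) (q x y)).
  { intros x y k H Hp. pose proof (principal_reflect_eigenvector c d g x y _ k Hcd Hp) as E.
    destruct (Hdir _ (Hdir1 x y H) (proj1 Hp)) as [m [Hm Em]]. rewrite Em in E.
    exact (eigenvector_e1 _ _ _ _ _ _ _ Hm E). }
  assert (HL : 0 <= c * a) by nra.
  assert (HT : 0 <= d * a) by nra.
  refine (moulding_unique kappa S G k2e K h (reflect c d U) _ _ _ _ _ _ eps (c * a) (d * a)
    HG Hh Heps HL HT J _ _ _ _ _ _ _).
  - intros s t Hs Ht. apply HC2, HPi; assumption.
  - intros s t Hs Ht. pose proof (HPi s t Hs Ht) as H.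
    destruct (proj1 (Hframe _ _ H)) as [k Hk]. exact (proj1 (HPC _ _ k H Hk)).
  (* The point of gamma_2 with second coordinate t has x = t / d, hence s = c x = alpha t. *)
  - intros t Ht. exists (alpha * t).
    assert (Hs : Rabs (alpha * t) <= c * a).
    { rewrite Rabs_mult, (Rabs_pos_eq alpha), Hc by lra. nra. }
    split; [exact Hs|].
    pose proof (HPi _ t Hs Ht) as H.
    assert (Ey : d * (alpha * t) - c * t = 0) by (rewrite Hc; ring).
    assert (Ex : c * (alpha * t) + d * t = t / d).
    { apply (Rmult_eq_reg_r d); [| lra].
      transitivity ((c ^ 2 + d ^ 2) * t); [rewrite Hc; ring | rewrite Hcd; field; lra]. }
    unfold reflect in *. rewrite Ex, Ey in *. set (x := t / d) in *.
    assert (Hx : gamma2_dom a1 x).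
    { unfold gamma2_dom, x, Rdiv. rewrite Rabs_mult, Rabs_inv, (Rabs_pos_eq d) by lra.
      apply (Rmult_le_reg_r d); [lra|]. rewrite Rmult_assoc, Rinv_l by lra. nra. }
    destruct (proj1 (Hframe _ _ H)) as [k Hk].
    destruct (HPC _ _ k H Hk) as [E1 _].
    pose proof (Hkk2 x Hx H) as Hp2.
    pose proof (principal_reflect_eigenvector c d g x 0 _ _ Hcd Hp2) as E2.
    rewrite <- Hk2 in E2 by assumption. replace (d * x) with t in E2 by (unfold x; field; lra).
    destruct (Hdir _ (Hdir1 _ _ H) (proj1 Hk)) as [m [Hm Em]].
    destruct (proj2 (Hframe _ _ H)) as [_ Horth].
    destruct (reflect_vec c d (d2 x 0)) as [v w] eqn:Ev.
    apply (eigenvector_orthogonal _ _ _ _ _ v w _ E1); [| | exact E2].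
    + rewrite <- Ev. apply reflect_vec_neq_0; [exact Hcd | apply Hp2].
    + rewrite <- (reflect_vec_involutive c d (d1 x 0) Hcd), Em in Horth.
      rewrite <- (reflect_vec_involutive c d (d2 x 0) Hcd), Ev in Horth.
      unfold tangent_vec, dot3, reflect_vec in Horth. cbn [fst snd] in Horth.
      apply (Rmult_eq_reg_l m); [| assumption]. rewrite Rmult_0_r.
      refine (eq_trans _ Horth).
      assert (Hd2' : d ^ 2 = 1 - c ^ 2) by lra. unfold p, q. ring [Hd2'].
  - intros s Hs.
    assert (H0 : Rabs 0 <= d * a) by (rewrite Rabs_R0; nra).
    pose proof (HPi s 0 Hs H0) as H.
    assert (Ex : c * s + d * 0 = alpha * (d * s)) by (rewrite Hc; ring).
    assert (Ey : d * s - c * 0 = d * s) by ring.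
    unfold reflect in *. rewrite Ex, Ey in *.
    assert (Hu : gamma1_dom alpha a1 (d * s)).
    { unfold gamma1_dom.
      assert (Er : / sqrt (alpha ^ 2 + 1) = d).
      { rewrite <- (Rinv_inv d). f_equal. apply sqrt_lem_1; [nra | left; now apply Rinv_0_lt_compat |].
        transitivity ((c ^ 2 + d ^ 2) / d ^ 2); [rewrite Hcd; field; lra | rewrite Hc; field; lra]. }
      unfold Rdiv. rewrite Er, Rabs_mult, (Rabs_pos_eq d) by lra.
      (* In terms of s, gamma_1 is |s| <= a1 alpha, which covers |s| <= c a because c = alpha d and
         d <= 1. *)
      assert (c * a <= a1 * alpha).
      { assert (d <= 1) by nra. subst c. nra. }
      nra. }
    destruct (HPC _ _ _ H (Hk1 _ Hu H)) as [_ E].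
    refine (eq_trans E _). rewrite <- Hkt by assumption.
    replace (d * s / d) with s by (field; lra). reflexivity.
  - unfold reflect. replace (d * 0 - c * 0) with 0 by ring.
    replace (c * 0 + d * 0) with 0 by ring. exact g0.
  - unfold reflect. replace (d * 0 - c * 0) with 0 by ring.
    replace (c * 0 + d * 0) with 0 by ring. rewrite gx0, gy0. ring.
  - unfold reflect. replace (d * 0 - c * 0) with 0 by ring.
    replace (c * 0 + d * 0) with 0 by ring. rewrite gx0, gy0. ring.
Qed.

End frame.

Theorem proposition1 :
  forall a1 alpha : R, 0 < a1 -> 0 < alpha ->
  forall a a' : R, 0 < a -> a < a' -> a' <= a1 ->
  exists delta : R, 0 < delta /\
  forall kt k2 : R -> R,
    C1_on (gamma1_dom alpha a1) kt ->
    continuous_on (gamma2_dom a1) k2 ->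
  forall kbar : R,
    is_maximum (curvature_values alpha a1 kt k2) kbar ->
    kbar < delta ->
  exists f : R -> R -> R,
    PC_solution alpha a1 kt k2 a f /\
    PC_solution alpha a1 kt k2 a' f /\
    forall g : R -> R -> R,
      PC_solution alpha a1 kt k2 a' g ->
      forall x y : R, Pi alpha a x y -> g x y = f x y.
Proof.
  intros a1 alpha Ha1 Halpha a a' Ha Haa' Ha'1.
  set (r := sqrt (alpha ^ 2 + 1)).
  assert (Hr : 0 < r) by (apply sqrt_lt_R0; nra).
  assert (Hr2 : r ^ 2 = alpha ^ 2 + 1) by (apply pow2_sqrt; nra).
  set (d := / r). set (c := alpha * d).
  assert (Hd : 0 < d) by now apply Rinv_0_lt_compat.
  assert (Hc : 0 < c) by now apply Rmult_lt_0_compat.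
  assert (Hcd : c ^ 2 + d ^ 2 = 1).
  { transitivity ((alpha ^ 2 + 1) / r ^ 2); [unfold c, d; field; lra | rewrite Hr2; field; nra]. }
  (* The extra 1 puts the closed range |t| <= d a' inside the open strip, as a' <= a1. *)
  set (T := d * a1 + 1).
  assert (HT : 0 < T) by (unfold T; nra).
  (* [m] bounds the displacement |h|: by 1 for the existence of [sigma], by c (a' - a) for the drift
     of the characteristics. *)
  set (m := Rmin 1 (c * (a' - a))).
  assert (Hm : 0 < m) by (apply Rmin_pos; nra).
  assert (Hm1 : m <= 1) by apply Rmin_l.
  assert (Hm2 : m <= c * (a' - a)) by apply Rmin_r.
  (* On the strip |h| <= 2 eps |t| <= 2 eps T <= m; the height bound itself needs eps <= 1/2. *)
  set (eps := Rmin (1 / 2) (m / (2 * T))).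
  assert (Heps0 : 0 < eps) by (apply Rmin_pos; [lra | apply Rdiv_lt_0_compat; lra]).
  assert (Heps1 : eps <= 1 / 2) by apply Rmin_l.
  assert (Heps2 : 2 * eps * T <= m).
  { assert (H : eps <= m / (2 * T)) by apply Rmin_r.
    replace m with (2 * (m / (2 * T)) * T) by (field; lra). nra. }
  destruct (profile_exists (a1 * alpha) (1 / 2)) as [delta1 [Hdelta1 Hex1]]; [nra | lra |].
  destruct (profile_exists (d * a1) eps) as [delta2 [Hdelta2 Hex2]]; [nra | lra |].
  exists (Rmin delta1 delta2). split; [now apply Rmin_pos|].
  intros kt k2 Hkt Hk2 kbar [_ Hmax] Hkbar.
  pose proof (Rmin_l delta1 delta2). pose proof (Rmin_r delta1 delta2).
  assert (Hscale1 : forall s, Rabs s <= a1 * alpha -> gamma1_dom alpha a1 (d * s)).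
  { intros s Hs. unfold gamma1_dom. fold r. unfold Rdiv. fold d.
    rewrite Rabs_mult, (Rabs_pos_eq d) by lra. nra. }
  assert (Hscale2 : forall t, Rabs t <= d * a1 -> gamma2_dom a1 (/ d * t)).
  { intros t Ht. unfold gamma2_dom.
    rewrite Rabs_mult, Rabs_inv, (Rabs_pos_eq d) by lra.
    apply (Rmult_le_reg_l d); [lra|]. rewrite <- Rmult_assoc, Rinv_r by lra. lra. }
  destruct (Hex1 (fun s => kt (d * s))) as (kappa & S & G & HG & Ekappa).
  { apply (continuous_on_scale d _ (gamma1_dom alpha a1)); [assumption|].
    now apply continuous_on_of_C1_on. }
  { intros s Hs. apply Rle_lt_trans with kbar; [| lra].
    (* [curvature_values] evaluates [kt] at u = x alpha d, and u = d s, hence x = s / alpha. *)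
    apply Hmax. exists (s / alpha). split.
    - unfold Rdiv. rewrite Rabs_mult, Rabs_inv, (Rabs_pos_eq alpha) by lra.
      apply (Rmult_le_reg_r alpha); [lra|]. rewrite Rmult_assoc, Rinv_l by lra. lra.
    - left. do 2 f_equal. fold r. unfold d. field. lra. }
  destruct (Hex2 (fun t => k2 (/ d * t))) as (k2e & K & h & Hh & Ek2e).
  { now apply (continuous_on_scale (/ d) _ (gamma2_dom a1)). }
  { intros t Ht. apply Rle_lt_trans with kbar; [| lra].
    apply Hmax. exists (/ d * t). split; [now apply Hscale2 | now right]. }
  assert (Hkappa : forall u, gamma1_dom alpha a1 u -> kappa (u / d) = kt u).
  { intros u Hu. rewrite Ekappa.
    - f_equal. field. lra.
    - unfold gamma1_dom in Hu. fold r in Hu. unfold Rdiv in *. fold d in Hu.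
      rewrite Rabs_mult, Rabs_inv, (Rabs_pos_eq d) by lra.
      apply (Rmult_le_reg_r d); [lra|]. rewrite Rmult_assoc, Rinv_l by lra. lra. }
  assert (Hk2e : forall x, gamma2_dom a1 x -> k2e (d * x) = k2 x).
  { intros x Hx. rewrite Ek2e.
    - f_equal. field. lra.
    - unfold gamma2_dom in Hx. rewrite Rabs_mult, (Rabs_pos_eq d) by lra. nra. }
  assert (Hhm : forall t, Rabs t < T -> Rabs (h t) <= m).
  { intros t Ht. pose proof (profile_height_bound eps k2e K h t Heps1 Hh). nra. }
  assert (Hh1 : forall t, Rabs t < T -> Rabs (h t) <= 1).
  { intros t Ht. pose proof (Hhm t Ht). lra. }
  destruct (foot_exists kappa S G HG) as [sigma Hfoot].
  assert (Heps : eps < 1) by lra.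
  exists (reflect c d (moulding S G h sigma)).
  split; [| split].
  - apply (moulding_PC_solution alpha c d Halpha Hd eq_refl Hcd a1 a kt k2 kappa S G k2e K h
      sigma eps T HG Hh Heps Hh1 Hfoot Ha); try assumption. unfold T. nra.
  - apply (moulding_PC_solution alpha c d Halpha Hd eq_refl Hcd a1 a' kt k2 kappa S G k2e K h
      sigma eps T HG Hh Heps Hh1 Hfoot); try assumption; [lra | unfold T; nra].
  - intros g Hg x y Hxy.
    apply (Pi_reflect alpha c d Hd eq_refl Hcd) in Hxy. destruct Hxy as [Hs Ht].
    rewrite <- (reflect_involutive c d g x y Hcd). unfold reflect at 1 3.
    set (s := c * x + d * y) in *. set (t := d * x - c * y) in *.
    assert (HtT : Rabs t < T) by (unfold T; nra).
    (* [x0] is the point of t = 0 from which the characteristic through (s, t) starts. *)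
    set (x0 := sigma s (h t)).
    pose proof (Hfoot s (h t) (Hh1 t HtT)) as Ex0. fold x0 in Ex0.
    unfold moulding. fold x0. rewrite <- Ex0 at 1.
    apply (PC_solution_moulding alpha c d Halpha Hd eq_refl Hcd a1 a' kt k2 kappa S G k2e K h
      eps g HG Hh Heps); try assumption; [lra | | nra].
    intros tau Htau.
    (* Because |S| <= 1/2, two points of this characteristic differ in s by at most m/2 + m/2 <= c
       (a' - a). From |s| <= c a it follows that all of it lies in |s| <= c a'. *)
    assert (HS : forall v, Rabs v < T -> Rabs (h v * S x0) <= m / 2).
    { intros v Hv. rewrite Rabs_mult. pose proof (Hhm v Hv).
      pose proof (profile_sine_bound _ _ _ _ HG x0).
      pose proof (Rabs_pos (h v)). pose proof (Rabs_pos (S x0)). nra. }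
    assert (HtauT : Rabs tau < T) by (unfold T; nra).
    pose proof (HS t HtT) as B1. pose proof (HS tau HtauT) as B2.
    apply Rabs_le_between in B1. apply Rabs_le_between in B2. apply Rabs_le_between in Hs.
    apply Rabs_le. lra.
Qed.
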